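(* Let $n$ be a natural number. For each natural number $a$, let $X(n,a)$ denote the set of integral solutions $(x,y)\in\mathbb{Z}\times\mathbb{Z}$ of the equation $x^2+ay^2=n$. (I) For $a=1,2$, we have $$|X(n,1)| = 4 \sum_{c\mid n} \left(\frac{-4}{c}\right) \quad\text{and}\quad |X(n,2)| = 2 \sum_{c\mid n} \left(\frac{-2}{c}\right).$$ (II) For $a=3$: (a) If $n$ is even, then $|X(n,3)| = 6\sum_{c\mid n} \left(\frac{c}{3}\right)$. (b) If $n$ is odd, then $|X(n,3)| = 2\sum_{c\mid n} \left(\frac{c}{3}\right)$. (III) For $a=7$: (a) If $4\mid n$, then $|X(n,7)| = 2\sum_{c\mid \frac{n}{4}} \left(\frac{c}{7}\right)$. (b) If $n$ is even but $4\nmid n$, then $X(n,7)=\emptyset$. (c) If $n$ is odd, then $|X(n,7)| = 2\sum_{c\mid n} \left(\frac{c}{7}\right)$. (IV) For every Heegner number $a\geq 11$: (a) If $n$ is even, then $|X(n,a)| = |Y(n,a)|$. (b) If $n$ is odd, then $$|X(n,a)| = \frac13\left[1+2\cdot\frac{\left(\frac{\tau(n_q)}{3}\right)}{\tau(n_q)}\right]\cdot|Y(n,a)|,$$ where $n_q$ denotes the product of all prime factors (including multiplicity) of $n$ which are quadratic residues modulo $a$ but not expressible as $x^2+ay^2$ for any integers $x,y$. (V) For $a=27$: (a) If $3 \mid n$, then $X(n,27)\neq \emptyset$ only if $9 \mid n$. In this case (i.e. if $9\mid n$), we have $|X(n,27)| = |X(\tfrac{n}{9},3)|$. (b) If $3\nmid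 n$ but $2\mid n$, then $|X(n,27)| = \frac13|X(n,3)|$. (c) If $\gcd(6,n)=1$, then $$|X(n,27)| = \frac13\left[1+2\cdot\frac{\left(\frac{\tau(n_q)}{3}\right)}{\tau(n_q)}\right]\cdot|X(n,3)|,$$ where $n_q$ denotes, in this part, the product of all prime factors $q$ (including multiplicity) of $n$ such that $q\equiv1\pmod{3}$ and $2$ is not a cubic residue modulo $q$.
   Context: Natural numbers are positive integers. Sums over $c\mid n$ run over the positive divisors $c$ of $n$, and $\tau(n)$ is the number of positive divisors of $n$. The symbol $\left(\frac{a}{n}\right)$ is the Kronecker symbol (the generalization of the Legendre symbol, multiplicative in both arguments). A Heegner number is a square-free natural number $a$ such that the ring of integers of $\mathbb{Q}(\sqrt{-a})$ is a unique factorization domain; these are exactly $1,2,3,7,11,19,43,67,163$. For a square-free natural number $a$, $\mathcal{O}_{-a}$ denotes the ring of integers in $\mathbb{Q}(\sqrt{-a})$, i.e. $\mathcal{O}_{-a}=\mathbb{Z}[\sqrt{-a}]$ if $a\equiv1,2\pmod 4$ and $\mathcal{O}_{-a}=\mathbb{Z}[\frac{-1+\sqrt{-a}}{2}]$ if $a\equiv3\pmod 4$. The norm of $z=x+y\sqrt{-a}$ with $x,y\in\mathbb{Q}$ is $N(z)=x^2+ay^2$, and $Y(n,a):=\{z\in\mathcal{O}_{-a} \mid N(z)=n\}$. The product of all prime factors with a given property ''including multiplicity'' means that each such prime $q$ contributes $q^{v_q(n)}$, where $v_q(n)$ is the exponent of $q$ in $n$; the empty product is $1$. *)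

(* Defs.v *)
From HB Require Import structures.
From mathcomp Require Import all_boot all_order all_algebra all_field.
From mathcomp Require Import ring.
From mathcomp Require Import finmap boolp classical_sets functions cardinality.

Set Implicit Arguments.
Unset Strict Implicit.
Unset Printing Implicit Defensive.

Import Order.TTheory GRing.Theory Num.Theory.

Local Open Scope classical_set_scope.
Local Open Scope ring_scope.

(* Junk value 0 on infinite sets; see [finite_solX] and [finite_solY]. *)
Definition card_of (T : choiceType) (A : set T) : nat := #|` fset_set A|%fset.

Definition tau (n : nat) : nat := size (divisors n).

(* For odd p this is the Legendre symbol. *)
Definition kronecker_prime (a : int) (p : nat) : int :=
  if p == 2%N then
    if (2 %| a)%Z then 0
    else if (a == 1 %[mod 8])%Z || (a == 7 %[mod 8])%Z then 1 else -1
  else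
    if (p %| a)%Z then 0
    else if [exists x : 'I_p, ((x : nat)%:Z ^+ 2 == a %[mod p])%Z] then 1
    else -1.

(* The sign in front of the product is the factor (a / -1)^[n < 0]. *)
Definition kronecker (a n : int) : int :=
  if n == 0 then (`|a|%N == 1%N)%:R
  else (if (n < 0) && (a < 0) then -1 else 1) *
       \prod_(p <- primes `|n|%N) kronecker_prime a p ^+ logn p `|n|%N.

(* As usual, residues are required to be coprime to the modulus m. *)
Definition power_residue (k m b : nat) : Prop :=
  coprime b m /\ exists x : nat, (x ^ k = b %[mod m])%N.

Definition irreducible_elt (R : idomainType) (p : R) : Prop :=
  [/\ p != 0, p \isn't a GRing.unit &
      forall x y : R, p = x * y -> x \is a GRing.unit \/ y \is a GRing.unit].

Definition associates (R : idomainType) (x y : R) : Prop :=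
  exists2 u : R, u \is a GRing.unit & y = u * x.

Definition irreducible_factorization (R : idomainType) (x : R) (s : seq R) :=
  (forall p, p \in s -> irreducible_elt p) /\ x = \prod_(p <- s) p.

Definition ufd (R : idomainType) : Prop :=
  forall x : R, x != 0 -> x \isn't a GRing.unit ->
    (exists s, irreducible_factorization x s) /\
    (forall s t, irreducible_factorization x s ->
       irreducible_factorization x t ->
       exists2 t', perm_eq t t' &
         size s = size t' /\
         forall i, (i < size s)%N -> associates s`_i t'`_i).

Definition sqrt_opp (a : nat) : algC := 'i * sqrtC a%:R.

Definition omega (a : nat) : algC :=
  if (a %% 4 == 3)%N then (-1 + sqrt_opp a) / 2 else sqrt_opp a.

(* Z[omega a], as the set of values at omega a of the integer polynomials *)
Definition quad_int : nat -> {pred algC} := fun a z =>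
  `[< exists p : {poly int}, z = (map_poly intr p).[omega a] >].

Lemma quad_int_subring a : subring_closed (quad_int a).
Proof.
split=> [|x y /asboolP[p ->] /asboolP[q ->]|x y /asboolP[p ->] /asboolP[q ->]];
  apply/asboolP.
- by exists 1; rewrite rmorph1 hornerC.
- by exists (p - q); rewrite rmorphB hornerD hornerN.
- by exists (p * q); rewrite rmorphM hornerM.
Qed.

HB.instance Definition _ a :=
  GRing.isSubringClosed.Build algC (quad_int a) (quad_int_subring a).

Record quadInt (a : nat) : Type :=
  QuadInt { quadInt_val : algC; quadInt_valP : quadInt_val \in quad_int a }.

HB.instance Definition _ a := [isSub for @quadInt_val a].
HB.instance Definition _ a := [Choice of quadInt a by <:].
HB.instance Definition _ a := [SubChoice_isSubComNzRing of quadInt a by <:].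

Section QuadIntIdomain.
Variable a : nat.
Implicit Types x y : quadInt a.

Definition quadInt_unit : pred (quadInt a) :=
  fun x => `[< exists y, y * x = 1 >].

Definition quadInt_inv x : quadInt a :=
  if pselect (exists y, y * x = 1) is left h then projT1 (cid h) else x.

Lemma quadInt_mulVx : {in quadInt_unit, left_inverse 1 quadInt_inv *%R}.
Proof.
move=> x /asboolP ux; rewrite /quadInt_inv; case: pselect => // h.
by case: (cid h).
Qed.

Lemma quadInt_unitP x y : y * x = 1 -> quadInt_unit x.
Proof. by move=> yx1; apply/asboolP; exists y. Qed.

Lemma quadInt_inv_out : {in [predC quadInt_unit], quadInt_inv =1 id}.
Proof.
move=> x /asboolPn nux; rewrite /quadInt_inv; case: pselect => // h.
Qed.

HB.instance Definition _ := GRing.ComNzRing_hasMulInverse.Build (quadInt a)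
  quadInt_mulVx quadInt_unitP quadInt_inv_out.

Lemma quadInt_integral x y : x * y = 0 -> (x == 0) || (y == 0).
Proof.
move=> /(congr1 (@quadInt_val a)) xy0; rewrite -!val_eqE /=.
by rewrite -mulf_eq0; apply/eqP.
Qed.

HB.instance Definition _ :=
  GRing.ComUnitRing_isIntegral.Build (quadInt a) quadInt_integral.

End QuadIntIdomain.

Definition squarefree (a : nat) : Prop :=
  forall d : nat, (d ^ 2 %| a)%N -> d = 1%N.

Definition heegner (a : nat) : Prop :=
  [/\ (0 < a)%N, squarefree a & ufd (quadInt a)].

Definition solX (n a : nat) : set (int * int) :=
  [set z | z.1 ^+ 2 + a%:Z * z.2 ^+ 2 = n%:Z].

(* N(x + y sqrt(-a)) = x^2 + a y^2 with x, y the rational coordinates *)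
Definition solY (n a : nat) : set (quadInt a) :=
  [set z | exists x y : rat,
     val z = ratr x + ratr y * sqrt_opp a /\
     x ^+ 2 + a%:R * y ^+ 2 = n%:R].
Arguments solY n a : clear implicits.

(* [n`_(nonrep_residues a)] collects, with multiplicity, the prime factors of
   n that are quadratic residues mod a but not of the form x^2 + a y^2. *)
Definition nonrep_residues (a : nat) : nat_pred :=
  [pred q | `[< power_residue 2 a q /\ solX q a = set0 >]].

Definition two_noncubic : nat_pred :=
  [pred q | (q == 1 %[mod 3])%N && `[< ~ power_residue 3 q 2 >]].

Lemma finite_solX (n a : nat) : (0 < a)%N -> finite_set (solX n a).
Proof.
move=> a0; set B := [set` [seq i%:Z - n%:Z | i <- iota 0 (n + n).+1]].
apply: (@sub_finite_set _ _ (B `*` B)); last first.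
  by apply: finite_setX; apply: finite_seq.
have inB (x : int) : x ^+ 2 <= n%:Z -> B x.
  move=> xn; have: `|x| <= n%:Z.
    apply: le_trans xn; rewrite -real_normK ?num_real //.
    have [->|x0] := eqVneq x 0; first by rewrite normr0.
    by rewrite expr2 ler_peMl // -gtz0_ge1 normr_gt0.
  rewrite ler_norml => /andP[x1 x2].
  have xn0 : 0 <= x + n%:Z by rewrite -lerBlDr sub0r.
  apply/mapP; exists (absz (x + n%:Z)); last by rewrite gez0_abs ?addrK.
  by rewrite mem_iota /= add0n ltnS -lez_nat gez0_abs // PoszD lerD2r.
move=> [x y] /= E; split; apply: inB => /=; rewrite -E /=.
  by rewrite lerDl mulr_ge0 // sqr_ge0.
apply: (@le_trans _ _ (a%:Z * y ^+ 2)); last by rewrite lerDr sqr_ge0.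
by rewrite ler_peMl ?sqr_ge0 // -gtz0_ge1.
Qed.

Lemma sqr_sqrt_opp a : sqrt_opp a ^+ 2 = - a%:R.
Proof. by rewrite exprMn sqrCi sqrtCK mulN1r. Qed.

Lemma sqr_omega a : exists u v : int, omega a ^+ 2 = u%:~R * omega a + v%:~R.
Proof.
rewrite /omega; case: ifP => [/eqP a3|_]; last first.
  by exists 0, (- a%:Z); rewrite sqr_sqrt_opp mul0r add0r rmorphN.
exists (-1), (- (a %/ 4).+1%:Z); have := sqr_sqrt_opp a.
have -> : (a%:R : algC) = (a %/ 4)%:R * 4 + 3.
  by rewrite {1}(divn_eq a 4) a3 natrD natrM.
set r := sqrt_opp a => r2.
rewrite !rmorphN /= rmorph1 -[_.+1%:~R]/((a %/ 4).+1%:R : algC) -natr1.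
rewrite expr_div_n sqrrD r2 sqrrN expr1n.
by field.
Qed.

Lemma quad_intP a (z : algC) :
  reflect (exists x y : int, z = x%:~R + y%:~R * omega a) (z \in quad_int a).
Proof.
apply: (iffP (asboolP _)) => [[p ->]|[x [y ->]]]; last first.
  exists (y%:P * 'X + x%:P); rewrite rmorphD rmorphM /= map_polyX !map_polyC.
  by rewrite hornerMXaddC hornerC addrC.
elim/poly_ind: p => [|p c [x [y E]]].
  by exists 0, 0; rewrite rmorph0 horner0 mul0r addr0.
have [u [v w2]] := sqr_omega a.
exists (y * v + c), (x + y * u).
rewrite rmorphD rmorphM /= map_polyX map_polyC hornerMXaddC E.
rewrite !rmorphD !rmorphM /= mulrDl -mulrA -expr2 w2; ring.
Qed.

Lemma sqr_norm_sqrt_opp a (x y : algC) : x \is Num.real -> y \is Num.real ->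
  `|x + y * sqrt_opp a| ^+ 2 = x ^+ 2 + a%:R * y ^+ 2.
Proof.
move=> xr yr; have ra : sqrtC (a%:R : algC) \is Num.real.
  by rewrite realE sqrtC_ge0 ler0n.
rewrite mulrCA normC2_rect ?rpredM // exprMn sqrtCK; ring.
Qed.

Lemma finite_solY (n a : nat) : (0 < a)%N -> finite_set (solY n a).
Proof.
move=> a0; pose h (s : int * int) : algC :=
  s.1%:~R / 2 + s.2%:~R / 2 * sqrt_opp a.
apply: (@sub_finite_set _ _ ((fun s => insubd (0 : quadInt a) (h s))
                             @` solX (4 * n) a)); last first.
  exact/finite_image/finite_solX.
move=> z [x [y [zE nE]]].
have [s hs] : exists s, val z = h s.
  have /quad_intP[u [v ->]] := valP z; rewrite /h /omega; case: ifP => _.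
    by exists (2 * u - v, v); rewrite /= rmorphB rmorphM /=; field.
  by exists (2 * u, 2 * v); rewrite /= !rmorphM /=; field.
exists s; last by apply: val_inj; rewrite -hs val_insubd (valP z).
have real_rat (r : rat) : ratr r \is @Num.real algC by apply: Creal_Crat; exact: Crat_rat.
have := sqr_norm_sqrt_opp a (real_rat x) (real_rat y).
rewrite -zE hs sqr_norm_sqrt_opp ?rpredM ?rpredV ?realz ?realn //.
have -> : ratr x ^+ 2 + a%:R * ratr y ^+ 2 = n%:R :> algC.
  by rewrite -!rmorphXn /= -(ratr_nat _ a) -rmorphM -rmorphD /= nE ratr_nat.
move=> E; apply: (@intr_inj algC).
rewrite rmorphD rmorphM /= !rmorphXn /= -!pmulrn natrM -E; by field.
Qed.

(* Main.v *)
(* A representation w of p n by a norm form N is divisible by pi or by its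
   conjugate when p = N(pi) is prime, and by both exactly when p divides w (p
   not dividing the discriminant). Hence for f on Z[t] that is compatible with
   multiplication by pi, the sums S(n) of f over N(z) = n satisfy a Hecke
   relation S(p n) + chi(p) S(n / p) = lam S(n), the last term being absent
   when p does not divide n. Such a sequence is determined by S(1) and the
   coefficients (lam, chi) at the primes. With f = 1 this gives (I)-(III), as
   divisor sums of chi satisfy the same relation. Z[sqrt(-a)] has index 2 in
   O_(-a), and Z[3 sqrt(-3)] index 3 in Z[sqrt(-3)]; away from the index, the
   subring is cut out by the kernel of a cubic character psi, so that three
   times the number of solutions is the sum of 1 + 2 Re psi. The sum of 2 Re psi
   is again a Hecke sequence, with lam = 2 Re psi(pi) = 2 or -1 at the split
   primes p = N(pi); this gives (IV) and (V).

   In (IV) the primes p = N(pi) are found by unique factorization, and "-a is a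
   square mod p" becomes "p is a square mod a" by a quadratic Gauss sum in a
   finite field. In (V) the value psi(pi) is read off the Jacobi sum
   J = sum_x chi(x (1 - x)) of a cubic character chi mod p: J is associate to pi
   or its conjugate, J = - p mod 3, and J = chi(2) mod 2 because x -> 1 - x
   fixes only x = 1/2. *)

Require Import Defs.
From HB Require Import structures.
From mathcomp Require Import all_boot all_order all_algebra all_field.
From mathcomp Require Import finmap boolp classical_sets functions cardinality.
From mathcomp Require Import cyclic ring zify.

Set Implicit Arguments.
Unset Strict Implicit.
Unset Printing Implicit Defensive.

Import Order.TTheory GRing.Theory Num.Theory.

Local Open Scope classical_set_scope.
Local Open Scope ring_scope.

(** * Norm forms of quadratic orders *)

(** The bijections between solution sets below take this shape: [h] is injective on [A], and its
    image is the part of [B] cut out by [P], which is a divisibility condition or trivial. *)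
Lemma sum_fset_set_reindex (T U : choiceType) (V : nmodType) (A : set T)
    (B : set U) (P : pred U) (h : T -> U) (f : U -> V) :
  finite_set A -> finite_set B ->
  (forall x x', A x -> A x' -> h x = h x' -> x = x') ->
  (forall x, A x -> B (h x) /\ P (h x)) ->
  (forall y, B y -> P y -> exists2 x, A x & h x = y) ->
  \sum_(y <- fset_set B | P y) f y = \sum_(x <- fset_set A) f (h x).
Proof.
move=> finA finB injh hB hA; rewrite -big_filter -(big_map h predT f).
apply: perm_big; apply: uniq_perm.
- by rewrite filter_uniq // fset_uniq.
- rewrite map_inj_in_uniq ?fset_uniq // => x x'.
  by rewrite !in_fset_set // => /set_mem Ax /set_mem Ax'; exact: injh.
move=> y; rewrite mem_filter in_fset_set //; apply/idP/mapP.
  move=> /andP[Py /set_mem By]; have [x Ax <-] := hA y By Py; exists x => //.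
  by rewrite in_fset_set // mem_set.
case=> x; rewrite in_fset_set // => /set_mem Ax ->.
by have [Bx ->] := hB x Ax; rewrite mem_set.
Qed.

Lemma card_ofE (T : choiceType) (A : set T) :
  (card_of A)%:Z = \sum_(x <- fset_set A) 1.
Proof. by rewrite big_const_seq count_predT -Monoid.iteropE -[LHS]natz. Qed.

Section Forms.
Variables b c : int.
Implicit Types z w : int * int.

Definition qnorm z : int := z.1 ^+ 2 + b * z.1 * z.2 + c * z.2 ^+ 2.

(* multiplication and conjugation in Z[t], t^2 = b t - c, for x + y t *)
Definition qmul z w : int * int :=
  (z.1 * w.1 - c * z.2 * w.2, z.1 * w.2 + z.2 * w.1 + b * z.2 * w.2).

Definition qconj z : int * int := (z.1 + b * z.2, - z.2).

Definition qscale (k : int) z : int * int := (k * z.1, k * z.2).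

Definition qdvd (k : int) z : bool := (k %| z.1)%Z && (k %| z.2)%Z.

Definition qsols (n : nat) : set (int * int) := [set z | qnorm z = n%:Z].

Definition qsum (f : int * int -> int) (n : nat) : int :=
  \sum_(z <- fset_set (qsols n)) f z.

Lemma qnormM z w : qnorm (qmul z w) = qnorm z * qnorm w.
Proof. by rewrite /qnorm /=; ring. Qed.

Lemma qnorm_conj z : qnorm (qconj z) = qnorm z.
Proof. by rewrite /qnorm /=; ring. Qed.

Lemma qnorm_scale k z : qnorm (qscale k z) = k ^+ 2 * qnorm z.
Proof. by rewrite /qnorm /=; ring. Qed.

Lemma qconjK z : qconj (qconj z) = z.
Proof. by case: z => x y; rewrite /qconj /=; congr (_, _); ring. Qed.

Lemma qmul_conjK z w : qmul (qconj z) (qmul z w) = qscale (qnorm z) w.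
Proof.
by case: w => x y; rewrite /qmul /qconj /qscale /qnorm /=; congr (_, _); ring.
Qed.

Lemma qmulK_conj z w : qmul z (qmul (qconj z) w) = qscale (qnorm z) w.
Proof.
by case: w => x y; rewrite /qmul /qconj /qscale /qnorm /=; congr (_, _); ring.
Qed.

Lemma qmul_scale k z w : qmul z (qscale k w) = qscale k (qmul z w).
Proof. by rewrite /qmul /qscale /=; congr (_, _); ring. Qed.

Lemma qscale_inj k : k != 0 -> injective (qscale k).
Proof. by move=> k0 [x y] [x' y'] [/(mulfI k0)-> /(mulfI k0)->]. Qed.

Lemma qdvdP k z : reflect (exists w, z = qscale k w) (qdvd k z).
Proof.
apply: (iffP andP) => [[/dvdzP[x x1] /dvdzP[y y1]]|[w ->]]; last first.
  by rewrite /= !dvdz_mulr.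
by exists (x, y); rewrite /qscale /= ![k * _]mulrC -x1 -y1 -surjective_pairing.
Qed.

Lemma qmul_inj z : qnorm z != 0 -> injective (qmul z).
Proof.
move=> z0 w w' /(congr1 (qmul (qconj z))); rewrite !qmul_conjK.
exact: qscale_inj.
Qed.

Lemma qnorm_disc z :
  4 * qnorm z = (2 * z.1 + b * z.2) ^+ 2 - (b ^+ 2 - 4 * c) * z.2 ^+ 2.
Proof. by rewrite /qnorm; ring. Qed.

Section Definite.
Hypothesis disc_lt0 : b ^+ 2 - 4 * c < 0.

Lemma qnorm_ge0 z : 0 <= qnorm z.
Proof. have := qnorm_disc z; nia. Qed.

Lemma qnorm_eq0 z : qnorm z = 0 -> z = (0, 0).
Proof.
move=> z0; have := qnorm_disc z; rewrite z0; case: z {z0} => x y /= E.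
have [E1 E2] : (2 * x + b * y) ^+ 2 = 0 /\ (b ^+ 2 - 4 * c) * y ^+ 2 = 0.
  by have := sqr_ge0 y; have := sqr_ge0 (2 * x + b * y); nia.
move/eqP: E2; rewrite mulf_eq0 lt_eqF //= sqrf_eq0 => /eqP y0.
by move/eqP: E1; rewrite y0 sqrf_eq0 => /eqP {}E; congr (_, _); lia.
Qed.

Lemma finite_qsols n : finite_set (qsols n).
Proof.
set B := [set` [seq i%:Z - (4 * `|c| * n + 4 * n)%:Z |
  i <- iota 0 (2 * (4 * `|c| * n + 4 * n)).+1]].
apply: (@sub_finite_set _ _ (B `*` B)); last first.
  by apply: finite_setX; apply: finite_seq.
have inB (m : nat) (x : int) : (m <= 4 * `|c| * n + 4 * n)%N ->
    x ^+ 2 <= m%:Z -> B x.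
  move=> mM xn; have {xn} xm : `|x| <= m%:Z by nia.
  apply/mapP; exists (absz (x + (4 * `|c| * n + 4 * n)%:Z)); last by lia.
  by rewrite mem_iota /=; lia.
have c_gt0 : 0 < c by have := sqr_ge0 b; lia.
have bound (d v y m : int) : d < 0 -> v ^+ 2 - d * y ^+ 2 = m -> y ^+ 2 <= m.
  by move=> d0 <-; have := sqr_ge0 y; have := sqr_ge0 v; nia.
move=> z nz; have zn : qnorm z = n%:Z by [].
split.
  (* Completing the square in either variable: 4 c N(z) = (b x + 2 c y)^2 - D x^2 bounds x, and 4
     N(z) = (2 x + b y)^2 - D y^2 bounds y, where D < 0 is the discriminant. *)
  apply: (inB (4 * `|c| * n)%N); first by rewrite leq_addr.
  apply: (bound _ (b * z.1 + 2 * c * z.2) _ _ disc_lt0).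
  by rewrite !PoszM gtz0_abs // -zn /qnorm; ring.
apply: (inB (4 * n)%N); first by rewrite leq_addl.
by apply: (bound _ (2 * z.1 + b * z.2) _ _ disc_lt0); rewrite -qnorm_disc zn.
Qed.

Lemma in_qsols z n : (z \in fset_set (qsols n)) = (qnorm z == n%:Z).
Proof.
rewrite in_fset_set; last exact: finite_qsols.
by apply/idP/eqP => [/set_mem|/mem_set].
Qed.

Section Prime.
Variables (p : nat) (u : int * int).
Hypotheses (p_prime : prime p) (up : qnorm u = p%:Z).

Lemma Euclidz (x y : int) : (p %| x * y)%Z = (p %| x)%Z || (p %| y)%Z.
Proof. by rewrite !dvdzE abszM Euclid_dvdM. Qed.

Lemma qnorm_sqr_dvd z : (p %| qnorm z)%Z -> (p %| z.2)%Z -> (p %| z.1)%Z.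
Proof.
move=> pz py; suff : (p %| z.1 * z.1)%Z by rewrite Euclidz orbb.
have -> : z.1 * z.1 = qnorm z - (b * z.1 + c * z.2) * z.2.
  by rewrite /qnorm; ring.
by apply: rpredB => //; exact: dvdz_mull.
Qed.

(** Otherwise p divides u, hence p^2 divides N(u) = p. *)
Lemma qnorm_prime_ndvd : ~~ (p %| u.2)%Z.
Proof.
apply/negP => pu2; have pu1 : (p %| u.1)%Z.
  by apply: qnorm_sqr_dvd => //; rewrite up.
have /qdvdP[w uw] : qdvd p u by rewrite /qdvd pu1.
move: up; rewrite uw qnorm_scale expr2 -mulrA -{3}[p%:Z]mulr1.
have p0 : p%:Z != 0 by have := prime_gt0 p_prime; lia.
move/(mulfI p0) => E; have : (p%:Z %| 1%R)%Z by rewrite -E dvdz_mulr.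
by rewrite dvdz1 absz_nat => /eqP p1; move: p_prime; rewrite p1.
Qed.

(** The norm of the product is a multiple of p, so by [qnorm_sqr_dvd] its second coordinate alone
    decides. *)
Lemma qdvd_conj_mul z : (p %| qnorm z)%Z ->
  qdvd p (qmul (qconj u) z) = (p %| u.1 * z.2 - u.2 * z.1)%Z.
Proof.
move=> pz; have E : (qmul (qconj u) z).2 = u.1 * z.2 - u.2 * z.1.
  by rewrite /qmul /qconj /=; ring.
apply/andP/idP => [[]|h]; first by rewrite E.
rewrite E; split=> //; apply: qnorm_sqr_dvd; last by rewrite E.
by rewrite qnormM dvdz_mull.
Qed.

Lemma qdvd_mul z : (p %| qnorm z)%Z ->
  qdvd p (qmul u z) = (p %| u.1 * z.2 + u.2 * z.1 + b * u.2 * z.2)%Z.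
Proof.
move=> pz; apply/andP/idP => [[]|h] //; split=> //.
by apply: qnorm_sqr_dvd => //; rewrite qnormM dvdz_mull.
Qed.

(** The second coordinates of conj(u) z and u z multiply to z.2^2 N(u) - u.2^2 N(z), which vanishes
    modulo p. *)
Lemma qdvd_mulU z : (p %| qnorm z)%Z ->
  qdvd p (qmul (qconj u) z) || qdvd p (qmul u z).
Proof.
move=> pz; rewrite qdvd_conj_mul // qdvd_mul // -Euclidz.
have -> : (u.1 * z.2 - u.2 * z.1) * (u.1 * z.2 + u.2 * z.1 + b * u.2 * z.2)
   = z.2 ^+ 2 * qnorm u - u.2 ^+ 2 * qnorm z by rewrite /qnorm; ring.
by apply: rpredB; apply: dvdz_mull => //; rewrite up.
Qed.

(** The two second coordinates add up to z.2 (2 u.1 + b u.2), and (2 u.1 + b u.2)^2 = 4 N(u) + D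
    u.2^2 with D the discriminant. As p divides neither D nor u.2, it must divide z.2. *)
Lemma qdvd_mulI z : (p %| qnorm z)%Z -> ~~ (p %| b ^+ 2 - 4 * c)%Z ->
  qdvd p (qmul (qconj u) z) && qdvd p (qmul u z) = qdvd p z.
Proof.
move=> pz pD; apply/andP/idP => [[]|/qdvdP[w ->]]; last first.
  by split; apply/qdvdP; eexists; exact: qmul_scale.
rewrite qdvd_conj_mul // qdvd_mul // => h1 h2.
have h3 : (p %| z.2 * (2 * u.1 + b * u.2))%Z.
  have -> : z.2 * (2 * u.1 + b * u.2) = (u.1 * z.2 - u.2 * z.1) +
    (u.1 * z.2 + u.2 * z.1 + b * u.2 * z.2) by ring.
  exact: rpredD.
have py : (p %| z.2)%Z.
  move: h3; rewrite Euclidz => /orP[//|h3].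
  have : (p %| (b ^+ 2 - 4 * c) * (u.2 * u.2))%Z.
    have -> : (b ^+ 2 - 4 * c) * (u.2 * u.2) =
      (2 * u.1 + b * u.2) * (2 * u.1 + b * u.2) - 4 * qnorm u.
      by rewrite /qnorm; ring.
    by apply: rpredB; apply: dvdz_mull => //; rewrite up.
  by rewrite !Euclidz (negbTE pD) (negbTE qnorm_prime_ndvd).
by rewrite /qdvd py qnorm_sqr_dvd.
Qed.

(** The second coordinates of u z and conj(u) z differ by u.2 (2 z.1 + b z.2), and (2 z.1 + b z.2)^2
    = 4 N(z) + D z.2^2 vanishes modulo p. So p divides both as soon as it divides one. *)
Lemma qdvd_ramified z : (p %| qnorm z)%Z -> (p %| b ^+ 2 - 4 * c)%Z ->
  qdvd p (qmul (qconj u) z).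
Proof.
move=> pz pD; have := qdvd_mulU pz; rewrite qdvd_conj_mul // qdvd_mul //.
have -> : u.1 * z.2 + u.2 * z.1 + b * u.2 * z.2 =
  (u.1 * z.2 - u.2 * z.1) + u.2 * (2 * z.1 + b * z.2) by ring.
rewrite [X in _ || X]rpredDr ?orbb //; apply: dvdz_mull.
suff : (p %| (2 * z.1 + b * z.2) * (2 * z.1 + b * z.2))%Z.
  by rewrite Euclidz orbb.
have -> : (2 * z.1 + b * z.2) * (2 * z.1 + b * z.2) =
   4 * qnorm z + (b ^+ 2 - 4 * c) * z.2 ^+ 2 by rewrite /qnorm; ring.
by apply: rpredD; [exact: dvdz_mull|exact: dvdz_mulr].
Qed.

End Prime.

(* Divisibility of z by v is tested as divisibility of (conj v) z by N(v). *)
Lemma qsum_mul (p n : nat) v f : prime p -> qnorm v = p%:Z ->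
  \sum_(z <- fset_set (qsols (p * n)) | qdvd p (qmul (qconj v) z)) f z
  = qsum (fun z => f (qmul v z)) n.
Proof.
move=> pp vp; have p0 : p%:Z != 0 :> int by have := prime_gt0 pp; lia.
apply: sum_fset_set_reindex.
- exact: finite_qsols.
- exact: finite_qsols.
- by move=> z w _ _; apply: qmul_inj; rewrite vp.
- move=> z zn; split; first by rewrite /qsols /= qnormM vp zn PoszM.
  by rewrite qmul_conjK vp; apply/qdvdP; exists z.
move=> y; rewrite /qsols /= => yn /qdvdP[w yw]; exists w; last first.
  by apply: (qscale_inj p0); rewrite -qmul_scale -yw qmulK_conj vp.
have := congr1 qnorm yw.
rewrite qnormM qnorm_conj qnorm_scale vp yn PoszM mulrA -expr2 => E.
by apply: (mulfI (expf_neq0 2 p0)); rewrite -E.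
Qed.

Lemma qsum_scale (p n : nat) f : prime p ->
  \sum_(z <- fset_set (qsols (p * n)) | qdvd p z) f z
  = if (p %| n)%N then qsum (fun z => f (qscale p z)) (n %/ p) else 0.
Proof.
move=> pp; have p0 : p%:Z != 0 :> int by have := prime_gt0 pp; lia.
have key w : qnorm (qscale p w) = (p * n)%N%:Z -> qnorm w * p = n%:Z.
  by rewrite qnorm_scale PoszM expr2 -mulrA => /(mulfI p0); rewrite mulrC.
case: ifPn => [pn|pn]; last first.
  rewrite big_seq_cond big_pred0 // => z; rewrite in_qsols; apply/negP.
  move=> /andP[/eqP zn /qdvdP[w zw]]; move: zn; rewrite zw => /key E.
  by move/negP: pn; apply; rewrite -[(p %| n)%N]/(p%:Z %| n%:Z)%Z -E dvdz_mull.
apply: sum_fset_set_reindex.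
- exact: finite_qsols.
- exact: finite_qsols.
- by move=> z w _ _; apply: qscale_inj.
- move=> z zn; split; last by apply/qdvdP; exists z.
  rewrite /qsols /= qnorm_scale zn.
  by rewrite -[in RHS](divnK pn) !PoszM; ring.
move=> y yn /qdvdP[w yw]; exists w => //; rewrite /qsols /=.
by apply: (mulIf p0); rewrite -PoszM divnK //; apply: key; rewrite -yw.
Qed.

(** Inclusion-exclusion over the solutions divisible by u and those divisible by its conjugate:
    [qdvd_mulU] describes the union and [qdvd_mulI] the intersection. *)
Lemma qsum_split (p n : nat) u f : prime p -> qnorm u = p%:Z ->
  ~~ (p %| b ^+ 2 - 4 * c)%Z ->
  qsum f (p * n) +
    (if (p %| n)%N then qsum (fun z => f (qscale p z)) (n %/ p) else 0) =
  qsum (fun z => f (qmul u z)) n + qsum (fun z => f (qmul (qconj u) z)) n.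
Proof.
move=> pp up pD; rewrite -qsum_scale // -(qsum_mul _ _ pp up) //.
rewrite -(@qsum_mul _ _ (qconj u) _ pp) ?qnorm_conj // qconjK /qsum.
rewrite ![\sum_(_ <- _ | _) _]big_mkcond /= -!big_split /= big_seq.
rewrite [RHS]big_seq; apply: eq_bigr => z.
rewrite in_qsols => /eqP zn.
have pz : (p %| qnorm z)%Z by rewrite zn PoszM dvdz_mulr.
have := qdvd_mulI pp up pz pD; have := qdvd_mulU pp up pz.
by case: (qdvd _ (qmul (qconj u) z)); case: (qdvd _ (qmul u z)) => //= _ <-;
  rewrite ?addr0 ?add0r.
Qed.

Lemma qsum_ramified (p n : nat) u f : prime p -> qnorm u = p%:Z ->
  (p %| b ^+ 2 - 4 * c)%Z ->
  qsum f (p * n) = qsum (fun z => f (qmul u z)) n.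
Proof.
move=> pp up pD; rewrite -(qsum_mul _ _ pp up) [RHS]big_mkcond /=.
rewrite /qsum big_seq [RHS]big_seq; apply: eq_bigr => z.
rewrite in_qsols => /eqP zn.
by rewrite qdvd_ramified // zn PoszM dvdz_mulr.
Qed.

Lemma qsum_inert (p n : nat) f : prime p ->
  (forall z, (p %| qnorm z)%Z -> qdvd p z) ->
  qsum f (p * n) =
    if (p %| n)%N then qsum (fun z => f (qscale p z)) (n %/ p) else 0.
Proof.
move=> pp pI; rewrite -qsum_scale // [RHS]big_mkcond /=.
rewrite /qsum big_seq [RHS]big_seq; apply: eq_bigr => z.
rewrite in_qsols => /eqP zn.
by rewrite pI // zn PoszM dvdz_mulr.
Qed.

(** If p does not divide z.2, then z.1 / z.2 is a root modulo p; the division uses a Bezout inverse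
    [l] of z.2. *)
Lemma no_root_inert (p : nat) : prime p ->
  (forall t : int, ~~ (p %| qnorm (t, 1%R))%Z) ->
  forall z, (p %| qnorm z)%Z -> qdvd p z.
Proof.
move=> pp noroot z pz; apply/contraT => nd.
have py : ~~ (p %| z.2)%Z.
  by apply: contra nd => py; rewrite /qdvd py (qnorm_sqr_dvd pp).
have cop : coprimez p z.2.
  by rewrite /coprimez; move: py; rewrite dvdzE -prime_coprime.
have /coprimezP[[k l] /= kl] := cop.
have /negP[] := noroot (l * z.1).
have lz : l * z.2 = 1 - k * p%:Z by rewrite -kl addrAC subrr add0r.
have -> : qnorm (l * z.1, 1%R) =
   l ^+ 2 * qnorm z + p%:Z * (k * (b * (l * z.1) + c * (1 + l * z.2))).
  have -> : l ^+ 2 * qnorm z =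
      (l * z.1) ^+ 2 + b * (l * z.1) * (l * z.2) + c * (l * z.2) ^+ 2.
    by rewrite /qnorm; ring.
  by rewrite lz /qnorm /=; ring.
by apply: rpredD; [exact: dvdz_mull|exact: dvdz_mulr].
Qed.

End Definite.
End Forms.

(** * Hecke relations and divisor sums *)

Definition hecke (F : nat -> int) (p : nat) (lam chi : int) : Prop :=
  forall n, (0 < n)%N ->
    F (p * n)%N + chi * (if (p %| n)%N then F (n %/ p)%N else 0) = lam * F n.

(** The coefficient of X^k in 1 / (1 - lam X + chi X^2). *)
Fixpoint hecke_coef (lam chi : int) (k : nat) : int :=
  if k is k1.+1 then
    if k1 is k2.+1 then
      lam * hecke_coef lam chi k1 - chi * hecke_coef lam chi k2
    else lam
  else 1.

Lemma heckeX F p lam chi k m : prime p -> ~~ (p %| m)%N -> hecke F p lam chi ->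
  F (p ^ k * m)%N = hecke_coef lam chi k * F m.
Proof.
move=> pp pm hF; have p0 := prime_gt0 pp.
have m0 : (0 < m)%N by case: m pm; rewrite ?dvdn0.
(* The recursion has order two, so two consecutive exponents are carried through the induction. *)
suff [] : F (p ^ k * m)%N = hecke_coef lam chi k * F m /\
  F (p ^ k.+1 * m)%N = hecke_coef lam chi k.+1 * F m by [].
elim: k => [|k [IH1 IH2]].
  split; first by rewrite expn0 !mul1n mul1r.
  by have := hF m m0; rewrite (negbTE pm) mulr0 addr0 expn1.
split=> //; have := hF (p ^ k.+1 * m)%N; rewrite muln_gt0 expn_gt0 p0 m0.
move=> /(_ isT); rewrite mulnA -expnS [in (_ %/ _)%N]expnS -mulnA mulKn //.
rewrite dvdn_mulr ?expnS ?dvdn_mulr // -expnS IH1 IH2 => E.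
by rewrite [hecke_coef _ _ k.+2]/= mulrBl -!mulrA -E addrK.
Qed.

(** The denominator factors: 1 - (1 + chi) X + chi X^2 = (1 - X) (1 - chi X). *)
Lemma hecke_coef_sum chi k :
  hecke_coef (1 + chi) chi k = \sum_(i < k.+1) chi ^+ i.
Proof.
suff [] : hecke_coef (1 + chi) chi k = \sum_(i < k.+1) chi ^+ i /\
  hecke_coef (1 + chi) chi k.+1 = \sum_(i < k.+2) chi ^+ i by [].
elim: k => [|k [IH1 IH2]]; first by rewrite !big_ord_recr big_ord0 /= !add0r.
split=> //; rewrite [LHS]/= -/(hecke_coef _ _ k.+1) IH1 IH2.
rewrite [in RHS]big_ord_recr /= [in LHS]big_ord_recr /= [in RHS]big_ord_recr /=.
by rewrite !exprS; ring.
Qed.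

(** The full power of the least prime factor is split off at each step. The modulus [N] excludes the
    primes, 2 and 3 in the applications, at which no Hecke relation is claimed. *)
Lemma coprime_ind (N : nat) (Q : nat -> Prop) : Q 1%N ->
  (forall p k m, prime p -> coprime N p -> ~~ (p %| m)%N -> coprime N m ->
     Q m -> Q (p ^ k * m)%N) ->
  forall n, (0 < n)%N -> coprime N n -> Q n.
Proof.
move=> Q1 QM; elim/ltn_ind => n IH n0 cn.
have [->//|n_gt1] : n = 1%N \/ (1 < n)%N by lia.
have pp := pdiv_prime n_gt1; set p := pdiv n in pp.
have [_ nE] : (p ^ logn p n * n`_p^')%N = (p ^ logn p n * n`_p^')%N /\
   n = (p ^ logn p n * n`_p^')%N by rewrite -p_part partnC.
have pn : p \in \pi(n) by rewrite mem_primes pp n0 pdiv_dvd.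
have cn' : coprime N n`_p^' by rewrite (coprime_dvdr _ cn) // dvdn_part.
rewrite nE; apply: QM => //.
- by rewrite (coprime_dvdr _ cn) // pdiv_dvd.
- have := part_pnat p^' n; rewrite p'natE //.
apply: IH => //.
rewrite {2}nE ltn_Pmull ?part_gt0 // -(exp1n (logn p n)) ltn_exp2r ?prime_gt1
  //.
by rewrite logn_gt0.
Qed.

Lemma hecke_unique (N : nat) (F G : nat -> int) (k : int) n :
  (forall p, prime p -> coprime N p ->
    exists lam chi, hecke F p lam chi /\ hecke G p lam chi) ->
  F 1%N = k * G 1%N -> (0 < n)%N -> coprime N n -> F n = k * G n.
Proof.
move=> hFG FG1; move: n; apply: (@coprime_ind N) => // p j m pp Np pm Nm IH.
have [lam [chi [hF hG]]] := hFG p pp Np.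
by rewrite (heckeX _ pp pm hF) (heckeX _ pp pm hG) IH; ring.
Qed.

Section DivisorSum.
Variable chi : nat -> int.
Hypothesis chiM : forall p n, prime p -> (0 < n)%N ->
  chi (p * n)%N = chi p * chi n.

(** The divisors of p n that are multiples of p are p times the divisors of n; the others are the
    divisors of n prime to p. The chi-term restores the divisors of n that are multiples of p. *)
Lemma hecke_divisor_sum p : prime p ->
  hecke (fun n => \sum_(c <- divisors n) chi c) p (1 + chi p) (chi p).
Proof.
move=> pp; have p0 := prime_gt0 pp.
have A n : (0 < n)%N -> \sum_(c <- divisors (p * n) | (p %| c)%N) chi c
    = chi p * \sum_(c <- divisors n) chi c.
  move=> n0; rewrite big_distrr /=.
  transitivity (\sum_(c <- map (muln p) (divisors n)) chi c); last first.
    rewrite big_map big_seq [RHS]big_seq; apply: eq_bigr => c.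
    by rewrite -dvdn_divisors // => /(dvdn_gt0 n0) c0; rewrite chiM.
  rewrite -big_filter; apply: perm_big; apply: uniq_perm.
  - by rewrite filter_uniq ?divisors_uniq.
  - rewrite map_inj_uniq ?divisors_uniq // => x y /eqP.
    by rewrite eqn_pmul2l // => /eqP.
  move=> c; rewrite mem_filter -dvdn_divisors ?muln_gt0 ?p0 //.
  apply/andP/mapP => [[/dvdnP[d ->]]|[d dn ->]].
    rewrite mulnC dvdn_pmul2l // => dn; exists d => //.
    by rewrite -dvdn_divisors.
  by rewrite dvdn_mulr // dvdn_pmul2l // dvdn_divisors.
have B n : (0 < n)%N -> \sum_(c <- divisors (p * n) | ~~ (p %| c)%N) chi c
    = \sum_(c <- divisors n | ~~ (p %| c)%N) chi c.
  move=> n0; rewrite -big_filter -[RHS]big_filter.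
  apply: perm_big; apply: uniq_perm; rewrite ?filter_uniq ?divisors_uniq //.
  move=> c; rewrite !mem_filter -!dvdn_divisors ?muln_gt0 ?p0 //.
  case: (boolP (p %| c)%N) => //= pc.
  by rewrite Gauss_dvdr // coprime_sym prime_coprime.
move=> n n0; rewrite (bigID (fun c => (p %| c)%N)) /= A // B //.
have -> : chi p * (if (p %| n)%N then \sum_(c <- divisors (n %/ p)) chi c else
  0)
   = \sum_(c <- divisors n | (p %| c)%N) chi c.
  case: ifP => pn.
    by rewrite -{2}(divnK pn) [(_ * p)%N]mulnC A // divn_gt0 // dvdn_leq.
  rewrite mulr0 big_seq_cond big_pred0 // => c; rewrite -dvdn_divisors //.
  by apply/negP => /andP[cn pc]; rewrite (dvdn_trans pc cn) in pn.
rewrite mulrDl mul1r [X in _ = X + _](bigID (fun c => (p %| c)%N)) /=; ring.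
Qed.

End DivisorSum.

Lemma tauX p k m : prime p -> ~~ (p %| m)%N ->
  tau (p ^ k * m) = (k.+1 * tau m)%N.
Proof.
move=> pp pm; have tauE n : (tau n)%:Z = \sum_(c <- divisors n) 1.
  by rewrite big_const_seq count_predT -Monoid.iteropE -[LHS]natz.
apply/eqP; rewrite -eqz_nat PoszM; apply/eqP.
have h := @hecke_divisor_sum (fun _ => 1) (fun _ _ _ _ => esym (mulr1 1)) p pp.
rewrite !tauE (heckeX k pp pm h) hecke_coef_sum; congr (_ * _).
under eq_bigr do rewrite expr1n.
by rewrite sumr_const card_ord natz.
Qed.

Lemma tau_gt0 n : (0 < n)%N -> (0 < tau n)%N.
Proof.
move=> n0; rewrite /tau; have := dvdn_divisors n n0.
by rewrite dvdnn; case: divisors.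
Qed.

Lemma kronecker3E (t : nat) : kronecker t 3 = nth 0 [:: 0; 1; -1] (t %% 3).
Proof.
rewrite /kronecker /= [primes _](_ : _ = [:: 3%N]) // big_seq1 mul1r.
rewrite [logn _ _](_ : _ = 1%N) // expr1 /kronecker_prime /=.
rewrite -[(_ %| _)%Z]/(3 %| t)%N /dvdn.
have sq : [exists x : 'I_3, ((x : nat)%:Z ^+ 2 == t%:Z %[mod 3%N])%Z] =
    (t %% 3 != 2)%N.
  apply/existsP/idP => [[x /eqP]|t2].
    by case: x => -[|[|[|//]]] /= _; lia.
  have [t0|t1] : (t %% 3 = 0 \/ t %% 3 = 1)%N by lia.
    by exists (@Ordinal 3 0 isT); apply/eqP => /=; lia.
  by exists (@Ordinal 3 1 isT); apply/eqP => /=; lia.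
rewrite sq; have : (t %% 3 < 3)%N by rewrite ltn_mod.
by case: (t %% 3)%N => [|[|[|]]].
Qed.

Lemma kronecker3M (s t : nat) :
  kronecker (s * t)%N%:Z 3 = kronecker s 3 * kronecker t 3.
Proof.
rewrite !kronecker3E -modnMm.
have : (s %% 3 < 3)%N by rewrite ltn_mod.
have : (t %% 3 < 3)%N by rewrite ltn_mod.
by case: (t %% 3)%N => [|[|[|]]] //; case: (s %% 3)%N => [|[|[|]]].
Qed.

(* hecke_coef (-1) 1 k is the sum of w^(2 i - k) over 0 <= i <= k, for w a
   primitive cube root of unity. *)
Lemma hecke_coef_cubic k : hecke_coef (-1) 1 k = kronecker k.+1 3.
Proof.
suff [] : hecke_coef (-1) 1 k = kronecker k.+1 3 /\
  hecke_coef (-1) 1 k.+1 = kronecker k.+2 3 by [].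
elim: k => [|k [IH1 IH2]]; first by rewrite !kronecker3E.
split=> //; rewrite [LHS]/= -/(hecke_coef _ _ k.+1) IH1 IH2 !kronecker3E.
have -> : (k.+2 %% 3 = (k.+1 %% 3).+1 %% 3)%N by lia.
have -> : (k.+3 %% 3 = (k.+1 %% 3).+2 %% 3)%N by lia.
have : (k.+1 %% 3 < 3)%N by rewrite ltn_mod.
by case: (k.+1 %% 3)%N => [|[|[|]]].
Qed.

(** At a prime of [pi] with exponent k, [r] gains the factor k + 1 and [g] the factor (k + 1 / 3),
    while [tau] of the [pi]-part gains k + 1. At any other prime [r] and [g] gain the same factor
    and the [pi]-part does not change. *)
Lemma hecke_cubic_formula (N : nat) (pi : nat_pred) (r g : nat -> int) n :
  (forall p, prime p -> coprime N p ->
    if p \in pi then hecke r p 2 1 /\ hecke g p (-1) 1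
    else exists lam chi, hecke r p lam chi /\ hecke g p lam chi) ->
  g 1%N = 2 * r 1%N -> (0 < n)%N -> coprime N n ->
  (tau n`_pi)%:Z * g n = 2 * kronecker (tau n`_pi) 3 * r n.
Proof.
move=> hrg rg1; move: n; apply: (@coprime_ind N) => [|p k m pp Np pm Nm IH].
  by rewrite partn1 rg1 (_ : tau 1 = 1%N) // kronecker3E mul1r mulr1.
have p0 := prime_gt0 pp; have m0 : (0 < m)%N by case: m pm {Nm IH};
  rewrite ?dvdn0.
have := hrg p pp Np; rewrite partnM ?expn_gt0 ?p0 //.
case: ifP => ppi [].
  move=> hr hg; rewrite (heckeX _ pp pm hr) (heckeX _ pp pm hg).
  rewrite part_pnat_id ?pnatX ?pnatE ?ppi //.
  have pm' : ~~ (p %| m`_pi)%N.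
    by apply: contra pm => h; rewrite (dvdn_trans h) ?dvdn_part.
  rewrite tauX // kronecker3M hecke_coef_cubic PoszM.
  rewrite (hecke_coef_sum 1); under eq_bigr do rewrite expr1n.
  rewrite sumr_const card_ord natz.
  transitivity (k.+1%:Z * kronecker k.+1 3 * ((tau m`_pi)%:Z * g m));
    first ring.
  by rewrite IH; ring.
move=> lam [chi [hr hg]].
rewrite (heckeX _ pp pm hr) (heckeX _ pp pm hg).
rewrite part_p'nat ?mul1n; last by rewrite pnatX pnatE //= !inE ppi.
by rewrite [LHS]mulrCA IH; ring.
Qed.

(** * Hecke relations for sums over norm forms *)

Section FormHecke.
Variables b c : int.
Hypothesis disc_lt0 : b ^+ 2 - 4 * c < 0.
Notation N := (qnorm b c).

Lemma hecke_split (f : int * int -> int) p u lam : prime p -> N u = p%:Z ->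
  ~~ (p %| b ^+ 2 - 4 * c)%Z ->
  (forall z, f (qscale p z) = f z) ->
  (forall z, f (qmul b c u z) + f (qmul b c (qconj b u) z) = lam * f z) ->
  hecke (qsum b c f) p lam 1.
Proof.
move=> pp up pD fp fu n n0; rewrite mul1r.
transitivity (qsum b c (fun z => f (qmul b c u z)) n
    + qsum b c (fun z => f (qmul b c (qconj b u) z)) n); last first.
  by rewrite /qsum -big_split /= big_distrr /=; apply: eq_bigr => z _.
rewrite -(qsum_split disc_lt0 _ _ pp up) //; congr (_ + _); case: ifP => // _.
by apply: eq_bigr => z _; rewrite fp.
Qed.

Lemma hecke_inert (f : int * int -> int) p : prime p ->
  (forall z, (p %| N z)%Z -> qdvd p z) ->
  (forall z, f (qscale p z) = f z) ->
  hecke (qsum b c f) p 0 (-1).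
Proof.
move=> pp pI fp n n0; rewrite mulN1r mul0r qsum_inert //.
case: ifP => _; last by rewrite subrr.
by apply/eqP; rewrite subr_eq0; apply/eqP/eq_bigr => z _; rewrite fp.
Qed.

Lemma hecke_ramified (f : int * int -> int) p u : prime p -> N u = p%:Z ->
  (p %| b ^+ 2 - 4 * c)%Z -> (forall z, f (qmul b c u z) = f z) ->
  hecke (qsum b c f) p 1 0.
Proof.
move=> pp up pD fu n n0;
  rewrite mul0r addr0 mul1r (qsum_ramified _ _ _ pp up) //.
by apply: eq_bigr => z _; rewrite fu.
Qed.

Lemma ramified_root p : prime p -> (p %| b ^+ 2 - 4 * c)%Z ->
  exists t : int, (p %| N (t, 1%R))%Z.
Proof.
move=> pp pD; have [p2|podd] := even_prime pp.
  (* For p = 2 the coefficient b is even, and N(c, 1) = b c + c (c + 1). *)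
  exists c; rewrite p2 in pp pD *; have b2 : (2%N %| b)%Z.
    suff : (2%N %| b * b)%Z by rewrite Euclidz // orbb.
    have -> : b * b = (b ^+ 2 - 4 * c) + 4 * c by ring.
    by apply: rpredD => //; apply: dvdz_mulr.
  have -> : N (c, 1) = b * c + c * (c + 1) by rewrite /qnorm /=; ring.
  apply: rpredD; [exact: dvdz_mulr|rewrite Euclidz //]; lia.
(* This is -b / 2 modulo p, the double root of t^2 + b t + c. *)
exists ((p.-1./2)%:Z * b).
suff : (p %| 4 * N ((p.-1./2)%:Z * b, 1%R))%Z.
  rewrite Euclidz // => /orP[p4|//]; move: podd.
  have : (p %| 2 * 2)%N by [].
  by rewrite Euclid_dvdM // orbb dvdn_prime2 // => /eqP ->.
rewrite qnorm_disc /=; apply: rpredB; last exact: dvdz_mulr.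
have -> : 2 * ((p.-1)./2%:Z * b) + b * 1 = p%:Z * b.
  have -> : p%:Z = 2 * (p.-1./2)%:Z + 1 by have := prime_gt0 pp; lia.
  ring.
by rewrite exprMn expr2 -mulrA dvdz_mulr.
Qed.

Hypothesis euclid : forall (k : int) z, 0 < k ->
  exists v : int * int, N (z.1 - k * v.1, z.2 - k * v.2) < k ^+ 2.

(* Fermat's descent: if N(w) = k p with 1 < k < p, reduce w mod k to z with
   N(z) < k^2; then w (conj z) / k has norm l p with l = N(z) / k < k. *)
Lemma euclid_represents p : prime p ->
  (exists t : int, (p %| N (t, 1%R))%Z) -> exists u, N u = p%:Z.
Proof.
move=> pp [t pt]; have p0 := prime_gt0 pp; have p1 := prime_gt1 pp.
have N0 z := qnorm_ge0 disc_lt0 z.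
have descent (k : nat) w : (0 < k < p)%N -> N w = (k * p)%N%:Z ->
    exists u, N u = p%:Z.
  elim/ltn_ind: k w => k IH w /andP[k0 kp] wk.
  have [k1|k1] : k = 1%N \/ (1 < k)%N by lia.
    by exists w; rewrite wk k1 mul1n.
  have kZ : 0 < k%:Z by lia.
  have [v] := euclid w kZ; set z := (_, _) => zk.
  have [l lE] : exists l : int, N z = k%:Z * l.
    (* N(w - k v) is expanded; every term other than N(w) = k p carries an explicit factor k. *)
    exists (p%:Z + b * (- w.1 * v.2 - v.1 * w.2 + k%:Z * v.1 * v.2)
      + (- 2 * w.1 * v.1 + k%:Z * v.1 ^+ 2)
      + c * (- 2 * w.2 * v.2 + k%:Z * v.2 ^+ 2)).
    by rewrite -[p%:Z]addr0 !mulrDr -PoszM -wk /z /qnorm /=; ring.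
  have lk : l < k%:Z by move: zk; rewrite lE expr2 ltr_pM2l.
  have l0 : 0 <= l by have := N0 z; rewrite lE pmulr_rge0.
  (* If l = 0 then w = k v, so k^2 divides k p and k divides p, against 1 < k < p. *)
  have {}l0 : 0 < l.
    rewrite lt_neqAle l0 andbT; apply/eqP => l0'.
    move: lE; rewrite -l0' mulr0 => /(qnorm_eq0 disc_lt0) [z1 z2].
    have ww : w = qscale k v.
      by case: (w) z1 z2 => x y /= ? ?; rewrite /qscale; congr (_, _); lia.
    move: wk; rewrite ww qnorm_scale PoszM expr2 -mulrA => /mulfI.
    rewrite gt_eqF // => /(_ isT) E.
    have : (k %| p)%N by rewrite -[(k %| p)%N]/(k%:Z %| p%:Z)%Z -E dvdz_mulr.
    by case/primeP: pp => _ h /h; lia.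
  (* This is w conj(z) / k: from z = w - k v follows w conj(z) = k p - k w conj(v). *)
  pose w' := (p%:Z - (qmul b c w (qconj b v)).1,
              - (qmul b c w (qconj b v)).2).
  have E : qscale k w' = qmul b c w (qconj b z).
    rewrite /qscale /w' /= mulrBr -PoszM -wk /z /qnorm /qmul /qconj /=.
    by congr (_, _); ring.
  have := congr1 N E; rewrite qnorm_scale qnormM qnorm_conj wk lE PoszM.
  have -> : k%:Z * p%:Z * (k%:Z * l) = k%:Z ^+ 2 * (l * p%:Z) by ring.
  move/mulfI; rewrite expf_neq0 ?gt_eqF // => /(_ isT) w'E.
  apply: (IH `|l|%N _ w'); [lia|lia|].
  by rewrite w'E PoszM gtz0_abs.
have pZ : 0 < p%:Z by lia.
(* Reducing (t, 1) modulo p gives a norm k p with k < p, from which the descent starts; k = 0 would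
   make p divide 1. *)
have [v] := euclid (t, 1) pZ; set z := (_, _) => zp.
have [k kE] : exists k : int, N z = k * p%:Z.
  have /dvdzP[s sE] := pt.
  exists (s + b * (- t * v.2 - v.1 + p%:Z * v.1 * v.2)
      + (- 2 * t * v.1 + p%:Z * v.1 ^+ 2)
      + c * (- 2 * v.2 + p%:Z * v.2 ^+ 2)).
  by rewrite -[s]addr0 !mulrDl -sE /z /qnorm /=; ring.
have kp : k < p%:Z by move: zp; rewrite kE expr2 ltr_pM2r.
have k0 : 0 <= k by have := N0 z; rewrite kE pmulr_lge0.
have {}k0 : 0 < k.
  rewrite lt_neqAle k0 andbT; apply/eqP => k0'.
  move: kE; rewrite -k0' mul0r => /(qnorm_eq0 disc_lt0) [_ /eqP].
  rewrite subr_eq0 => /eqP E.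
  have : (p%:Z %| 1%R)%Z by rewrite E dvdz_mulr.
  by rewrite dvdz1 absz_nat; lia.
apply: (descent `|k|%N z); first lia.
by rewrite kE PoszM gtz0_abs.
Qed.

(** Ramified, split and inert primes have [lam] equal to 1, 2 and 0, which is [1 + chi] each time;
    [euclid_represents] supplies the element of norm p in the first two cases. *)
Lemma hecke_qsum1 p (chi : int) : prime p ->
  ((p %| b ^+ 2 - 4 * c)%Z -> chi = 0) ->
  (~~ (p %| b ^+ 2 - 4 * c)%Z ->
     (exists t : int, (p %| N (t, 1%R))%Z) -> chi = 1) ->
  (~~ (p %| b ^+ 2 - 4 * c)%Z ->
     ~ (exists t : int, (p %| N (t, 1%R))%Z) -> chi = -1) ->
  hecke (qsum b c (fun=> 1)) p (1 + chi) chi.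
Proof.
move=> pp chi0 chi1 chiN; have [pD|pD] := boolP (p %| b ^+ 2 - 4 * c)%Z.
  have [u up] := euclid_represents pp (ramified_root pp pD).
  by rewrite chi0 // addr0; apply: (hecke_ramified pp up).
have [ht|ht] := pselect (exists t : int, (p %| N (t, 1%R))%Z).
  have [u up] := euclid_represents pp ht.
  by rewrite chi1 //; apply: (hecke_split pp up).
rewrite chiN // subrr; apply: hecke_inert => //.
by apply: no_root_inert => // t; apply/negP => tp; apply: ht; exists t.
Qed.

End FormHecke.

Lemma int_round (k m : int) : 0 < k -> exists q : int, `|2 * (m - k * q)| <= k.
Proof.
move=> k0; exists ((2 * m + k) %/ (2 * k))%Z.
have k20 : 2 * k != 0 by lia.
have E := divz_eq (2 * m + k) (2 * k).
have l0 := modz_ge0 (2 * m + k) k20.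
have l1 : ((2 * m + k) %% (2 * k))%Z < 2 * k by rewrite ltz_pmod //; lia.
set q := (_ %/ _)%Z in E *; set s := (_ %% _)%Z in E l0 l1.
have {}E : 2 * (m - k * q) = s - k by rewrite mulrBr; lia.
by rewrite E; lia.
Qed.

Lemma euclid_form0 (c k : int) (z : int * int) : 0 < c < 3 -> 0 < k ->
  exists v : int * int, qnorm 0 c (z.1 - k * v.1, z.2 - k * v.2) < k ^+ 2.
Proof.
move=> c3 k0; have [q1 h1] := int_round z.1 k0;
  have [q2 h2] := int_round z.2 k0.
exists (q1, q2); rewrite /qnorm /=; move: (_ - _) (_ - _) h1 h2 => x y hx hy.
have hx2 : 4 * x ^+ 2 <= k ^+ 2 by nia.
have hy2 : 4 * y ^+ 2 <= k ^+ 2 by nia.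
by have := sqr_ge0 y; nia.
Qed.

(** Rounding y first and then 2 x - y leaves |y| <= k / 2 and |2 x - y| <= k, so 4 N = (2 x - y)^2 +
    (4 c - 1) y^2 is at most k^2 + 7 k^2 / 4 < 4 k^2. *)
Lemma euclid_formN1 (c k : int) (z : int * int) : 0 < c < 3 -> 0 < k ->
  exists v : int * int, qnorm (-1) c (z.1 - k * v.1, z.2 - k * v.2) < k ^+ 2.
Proof.
move=> c3 k0; have [q2 h2] := int_round z.2 k0.
have [|q1 h1] := @int_round (2 * k) (2 * z.1 - (z.2 - k * q2)); first lia.
exists (q1, q2); set w := (_, _).
have : 4 * qnorm (-1) c w = (2 * w.1 - w.2) ^+ 2 + (4 * c - 1) * w.2 ^+ 2.
  by rewrite /qnorm; ring.
have {}h1 : `|2 * w.1 - w.2| <= k.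
  by move: h1; rewrite /w /=; lia.
have hx2 : (2 * w.1 - w.2) ^+ 2 <= k ^+ 2 by nia.
have hy2 : 4 * w.2 ^+ 2 <= k ^+ 2 by move: h2; rewrite -[_ - _]/(w.2); nia.
by have := sqr_ge0 w.2; nia.
Qed.

(** * Quadratic Gauss sums *)

Lemma ex_root_ext (F : finFieldType) (p : {poly F}) : (1 < size p)%N ->
  exists (L : splittingFieldType F) (z : L), root (map_poly (in_alg L) p) z.
Proof.
move=> p1; have p0 : p != 0 by rewrite -size_poly_gt0 (ltn_trans _ p1).
have [L [rs /= eq_rs _]] := FinSplittingFieldFor p0.
move: (eqp_size eq_rs); rewrite size_map_poly size_prod_XsubC => sz.
case: rs eq_rs sz => [|z rs] eq_rs sz; first by rewrite sz in p1.
exists L, z; rewrite (eqp_root eq_rs) root_prod_XsubC mem_head //.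
Qed.

Section GaussSum.
Variables (a : nat) (L : fieldType) (zeta : L).
Hypotheses (a_prime : prime a) (a3 : (a %% 4 = 3)%N).
Hypotheses (zeta1 : zeta ^+ a = 1) (zeta_neq1 : zeta != 1).

Let h := a.-1./2.

Let aE : (a = h.*2.+1 /\ odd h)%N.
Proof. by rewrite /h; lia. Qed.

(** The Legendre symbol by Euler's criterion, with values in [L]. *)
Let quad_char (x : 'F_a) : L :=
  if x ^+ h == 1 then 1 else if x == 0 then 0 else -1.

(** The additive character of the field attached to [zeta]. *)
Let E (x : 'F_a) : L := zeta ^+ x.

Let powh (x : 'F_a) : x != 0 -> x ^+ h = 1 \/ x ^+ h = -1.
Proof.
move=> x0; have xa := expf_card x; rewrite card_Fp // in xa.
have : x ^+ h.*2.+1 = x by rewrite -(proj1 aE).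
rewrite exprS -{3}[x]mulr1 => /(mulfI x0) /eqP.
by rewrite -muln2 exprM sqrf_eq1 => /orP[] /eqP; [left|right].
Qed.

Let charF : a \in [pchar 'F_a]. Proof. exact: pchar_Fp. Qed.

Let neq1N1 : (-1 == 1 :> 'F_a) = false.
Proof.
apply/eqP => e; have : (2%:R : 'F_a) = 0 by rewrite mulr2n -{1}e addNr.
move/eqP; rewrite -(dvdn_pcharf charF) => /dvdn_leq => /(_ isT); move: a3.
by have := prime_gt1 a_prime; lia.
Qed.

Let h_gt0 : (0 < h)%N. Proof. by case: aE => _; case: h. Qed.

Let quad_char0 : quad_char 0 = 0.
Proof. by rewrite /quad_char expr0n eqn0Ngt h_gt0 eq_sym oner_eq0 eqxx. Qed.

Let quad_charM x y : quad_char (x * y) = quad_char x * quad_char y.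
Proof.
have [->|x0] := eqVneq x 0; first by rewrite mul0r quad_char0 mul0r.
have [->|y0] := eqVneq y 0; first by rewrite mulr0 quad_char0 mulr0.
rewrite /quad_char mulf_eq0 (negbTE x0) (negbTE y0) exprMn /=.
case: (powh x0) => ->; case: (powh y0) => ->;
  by rewrite !(mulrNN, mulrN1, mulN1r, mulr1, mul1r, opprK, eqxx, neq1N1).
Qed.

Let quad_char_sqr x : x != 0 -> quad_char x * quad_char x = 1.
Proof.
move=> x0; rewrite /quad_char (negbTE x0).
by case: ifP => _; rewrite ?mulr1 ?mulrNN ?mulr1.
Qed.

Let quad_charN1 : quad_char (-1) = -1.
Proof.
by rewrite /quad_char -signr_odd aE.2 expr1 neq1N1 oppr_eq0 oner_eq0.
Qed.

Let ED x y : E (x + y) = E x * E y.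
Proof.
have z1 : zeta ^+ (Zp_trunc (pdiv a)).+2 = 1 by rewrite Fp_cast.
by rewrite /E /= -exprD expr_mod.
Qed.

Let E0 : E 0 = 1. Proof. by rewrite /E expr0. Qed.

Let EMn x n : E (x *+ n) = E x ^+ n.
Proof.
by elim: n => [|n IH]; rewrite ?mulr0n ?E0 // mulrS ED IH exprS.
Qed.

Let E_sum : \sum_x E x = 0.
Proof.
have E1 : E 1 = zeta by rewrite /E /= modn_small ?expr1.
have : \sum_x E x = zeta * \sum_x E x.
  rewrite {1}(reindex_inj (addrI 1)) /= big_distrr /=.
  by apply: eq_bigr => x _; rewrite ED E1.
move/eqP; rewrite -subr_eq0 -{1}[\sum_x E x]mul1r -mulrBl mulf_eq0 subr_eq0.
by rewrite eq_sym (negbTE zeta_neq1) => /eqP.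
Qed.

Let E_sumM u : \sum_x E (x * u) = if u == 0 then a%:R else 0.
Proof.
case: eqVneq => [->|u0].
  under eq_bigr do rewrite mulr0 E0.
  by rewrite sumr_const card_Fp.
by rewrite -[RHS]E_sum [RHS](reindex_inj (mulIf u0)).
Qed.

(** As a = 3 mod 4, -1 is a nonresidue, so x -> -x turns the sum into its opposite. The second
    alternative is characteristic two. *)
Let quad_char_sum : \sum_x quad_char x = 0 \/ 2%:R = 0 :> L.
Proof.
have e : \sum_x quad_char x = - \sum_x quad_char x.
  rewrite {1}(reindex_inj (@oppr_inj _)) -sumrN; apply: eq_bigr => x _.
  by rewrite -mulN1r quad_charM quad_charN1 mulN1r.
have /eqP : 2%:R * \sum_x quad_char x = 0 by rewrite mulr_natl mulr2n {1}e
  addNr.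
by rewrite mulf_eq0 => /orP[] /eqP; [right|left].
Qed.

Let g := \sum_x quad_char x * E x.

(** Substituting y = t x in the double sum leaves the symbol of t times the sum of E (x (t + 1))
    over x != 0, which is a - 1 for t = -1 and -1 otherwise. Only the symbol of -1, which is -1,
    survives. *)
Lemma gauss_sum_sqr : 2%:R != 0 :> L -> g ^+ 2 = - a%:R.
Proof.
move=> two; have cs : \sum_x quad_char x = 0.
  by case: quad_char_sum => // e; rewrite e eqxx in two.
rewrite expr2 {1}/g big_distrl /= (bigD1 0) //= quad_char0 !mul0r add0r.
transitivity (\sum_(x : 'F_a | x != 0) \sum_t quad_char t * E (x * (t + 1))).
  apply: eq_bigr => x x0; rewrite /g (reindex_inj (mulIf x0)) /= big_distrr /=.
  apply: eq_bigr => t _; rewrite quad_charM mulrACA [quad_char x * _]mulrCA.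
  by rewrite quad_char_sqr // mulr1 -ED mulrDr mulr1 addrC [t * x]mulrC.
rewrite exchange_big /=.
transitivity (\sum_t quad_char t * ((if t == -1 then a%:R else 0) - 1)).
  apply: eq_bigr => t _; rewrite -big_distrr /=; congr (_ * _).
  rewrite -(addr_eq0 t 1) -(E_sumM (t + 1)) [in RHS](bigD1 0) //= mul0r E0.
  by rewrite [RHS]addrC addKr.
under eq_bigr do rewrite mulrBr mulr1.
rewrite sumrB cs subr0 (bigD1 (-1)) //= eqxx quad_charN1 big1 ?addr0 ?mulN1r //.
by move=> t /negbTE ->; rewrite mulr0.
Qed.

(** Frobenius fixes the symbols, since q is odd, and sends E x to E (q x). Reindexing by q
    multiplies the sum by the symbol of q, which is 1. *)
Lemma gauss_sum_frob (q : nat) (s : 'F_a) : q \in [pchar L] -> odd q ->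
  s != 0 -> q%:R = s ^+ 2 -> g ^+ q = g.
Proof.
move=> chq oddq s0 qs; rewrite -(pFrobenius_autE chq) rmorph_sum /=.
have q0 : (q%:R : 'F_a) != 0 by rewrite qs expf_neq0.
have qc : quad_char q%:R = 1 by rewrite qs expr2 quad_charM quad_char_sqr.
rewrite /g [RHS](reindex_inj (mulIf q0)); apply: eq_bigr => x _.
rewrite rmorphM /= !pFrobenius_autE quad_charM qc mulr1 mulr_natr EMn.
congr (_ * _); rewrite /quad_char.
case: ifP => _; first exact: expr1n.
case: ifP => _; first by rewrite expr0n; case: q oddq {chq qs q0 qc}.
by rewrite -signr_odd oddq.
Qed.

End GaussSum.

(* The half of quadratic reciprocity that does not come for free from a
   representation of q by the form of discriminant -a. *)
Lemma sqr_mod_opp (a q : nat) (s : int) : prime a -> (a %% 4 = 3)%N ->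
  prime q -> q != a -> (a %| s ^+ 2 - q%:Z)%Z ->
  exists x : int, (q %| x ^+ 2 + a%:Z)%Z.
Proof.
move=> pa a3 pq qa sq; have [q2|oddq] := even_prime pq.
  by exists 1; rewrite q2; lia.
(* As q differs from a, the roots of 1 + X + ... + X^(a-1) are a-th roots of unity other than 1. *)
pose P : {poly 'F_q} := \poly_(i < a) 1.
have a1 := prime_gt1 pa.
have sP : size P = a by rewrite size_poly_eq ?oner_eq0.
have [|L [z rz]] := @ex_root_ext 'F_q P; first by rewrite sP.
have chL : q \in [pchar L].
  by rewrite (fmorph_pchar (in_alg L)) pchar_Fp.
have PE : map_poly (in_alg L) P = \poly_(i < a) 1.
  apply/polyP => i; rewrite coef_map !coef_poly /=.
  by case: ifP => _; rewrite ?scale1r ?scale0r.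
have sum0 : \sum_(i < a) z ^+ i = 0.
  move: rz; rewrite PE /root horner_poly => /eqP e; rewrite -[RHS]e.
  by apply: eq_bigr => i _; rewrite mul1r.
have z1 : z ^+ a = 1.
  by apply/eqP; rewrite -subr_eq0 subrX1 sum0 mulr0.
have zn1 : z != 1.
  apply/eqP => ze; move: sum0; rewrite ze.
  under eq_bigr do rewrite expr1n.
  rewrite sumr_const card_ord => /eqP; rewrite -(dvdn_pcharf chL).
  by rewrite dvdn_prime2 // (negbTE qa).
have two : 2%:R != 0 :> L.
  rewrite -(dvdn_pcharf chL) dvdn_prime2 //.
  by apply: contraL oddq => /eqP ->.
pose t : 'F_a := s%:~R.
have charA := pchar_Fp pa.
have int0 (m : int) : ((m%:~R : 'F_a) == 0) = (a %| m)%Z.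
  by rewrite -(dvdz_pcharf charA).
have qt : q%:R = t ^+ 2.
  apply/eqP; rewrite eq_sym -subr_eq0 /t -rmorphXn -[q%:R]/(q%:Z%:~R).
  by rewrite -rmorphB int0.
have t0 : t != 0.
  apply/eqP => te; move/eqP: qt; rewrite te expr0n /= -(dvdn_pcharf charA).
  by rewrite dvdn_prime2 // eq_sym (negbTE qa).
have g2 := gauss_sum_sqr pa a3 z1 zn1 two.
have gq := gauss_sum_frob pa a3 z1 zn1 chL oddq t0 qt.
set g := \sum_x _ in g2 gq.
(* Being fixed by Frobenius, g is a root of X^q - X, which splits over the prime field. *)
have [x gx] : exists x : 'F_q, g = x%:A.
  have : root (map_poly (in_alg L) ('X^#|'F_q| - 'X)) g.
    rewrite rmorphB /= map_polyXn map_polyX /root !hornerE card_Fp // gq.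
    by rewrite subrr.
  rewrite finField_genPoly rmorph_prod /= /root horner_prod prodf_seq_eq0.
  case/hasP => x _ /=; rewrite rmorphB /= map_polyX map_polyC !hornerE.
  by rewrite subr_eq0 => /eqP ->; exists x.
exists (x : nat)%:Z; have chq := pchar_Fp pq.
have xE : x ^+ 2 + a%:R = 0.
  apply: (fmorph_inj (in_alg L)); rewrite rmorph0 rmorphD rmorphXn rmorph_nat.
  by transitivity (g ^+ 2 + a%:R); [rewrite gx|rewrite g2 addNr].
rewrite (dvdz_pcharf chq) rmorphD rmorphXn /=.
by rewrite -[((x : nat)%:Z)%:~R]/((x : nat)%:R) natr_Zp; apply/eqP.
Qed.

(** * The classical formulas *)

Lemma card_solX n a : (card_of (solX n a))%:Z = qsum 0 a%:Z (fun=> 1) n.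
Proof.
rewrite card_ofE /qsum; congr (\sum_(_ <- fset_set _) _).
by apply/seteqP; split=> z; rewrite /solX /qsols /qnorm /= mul0r mul0r addr0.
Qed.

Lemma qsum_explicit b c f n (s : seq (int * int)) : b ^+ 2 - 4 * c < 0 ->
  uniq s -> (forall z, (qnorm b c z = n%:Z) <-> z \in s) ->
  qsum b c f n = \sum_(z <- s) f z.
Proof.
move=> D us hs; apply: perm_big; apply: uniq_perm => // z.
by rewrite in_qsols //; apply/eqP/idP => /hs.
Qed.

Lemma qsum_unit b c u f n : b ^+ 2 - 4 * c < 0 -> qnorm b c u = 1 ->
  qsum b c (fun z => f (qmul b c u z)) n = qsum b c f n.
Proof.
move=> D u1; have inj : injective (qmul b c u) by apply: qmul_inj; rewrite u1.
symmetry; apply: sum_fset_set_reindex; rewrite ?finite_qsols //.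
- exact: finite_qsols.
- exact: finite_qsols.
- by move=> x x' _ _ /inj.
- by move=> z zn; split=> //; rewrite /qsols /= qnormM u1 mul1r.
move=> z zn _; exists (qmul b c (qconj b u) z).
  by rewrite /qsols /= qnormM qnorm_conj u1 mul1r.
by rewrite qmulK_conj u1 /qscale !mul1r -surjective_pairing.
Qed.

(** * Comparison of x^2 + (4c - 1) y^2 with x^2 - x y + c y^2 *)

Section HalfInteger.
Variable c : int.
Hypothesis c0 : 0 < c.

Let D : (-1) ^+ 2 - 4 * c < 0. Proof. lia. Qed.
Let D' : 0 ^+ 2 - 4 * (4 * c - 1) < 0. Proof. lia. Qed.

(** For a = 4 c - 1, sqrt(-a) = 1 + 2 t, so x + y sqrt(-a) = (x + y) + 2 y t. *)
Lemma qsum_form0_even f n : qsum 0 (4 * c - 1) f n =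
  \sum_(z <- fset_set (qsols (-1) c n) | (2 %| z.2)%Z)
     f (z.1 - (z.2 %/ 2)%Z, (z.2 %/ 2)%Z).
Proof.
symmetry; rewrite (@sum_fset_set_reindex _ _ _ (qsols 0 (4 * c - 1) n) _ _
  (fun z => (z.1 + z.2, 2 * z.2))).
- apply: eq_bigr => z _ /=; congr f; case: z => x y /=.
  by congr (_, _); lia.
- exact: finite_qsols.
- exact: finite_qsols.
- by move=> [x y] [x' y'] _ _ [] /= ? ?; congr (_, _); lia.
- move=> z; rewrite /qsols /= => <-; split; last exact: dvdz_mulr.
  by rewrite /qnorm /=; ring.
move=> [x y] zn /dvdzP[y' /= yE]; exists (x - y', y').
  by rewrite /qsols /= -zn yE /qnorm /=; ring.
by rewrite yE /=; congr (_, _); lia.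
Qed.

(** A solution for 4 n has x and y of equal parity, so (x + y sqrt(-a)) / 2 lies in Z[t] and has
    norm n. *)
Lemma qsum_form0_mul4 n : qsum 0 (4 * c - 1) (fun=> 1) (4 * n) =
  qsum (-1) c (fun=> 1) n.
Proof.
rewrite /qsum; apply: (@sum_fset_set_reindex _ _ _ (qsols (-1) c n) _ predT
  (fun z => (2 * z.1 - z.2, z.2)) (fun=> 1)).
- exact: finite_qsols.
- exact: finite_qsols.
- by move=> [x y] [x' y'] _ _ [] /= ? ?; congr (_, _); lia.
- move=> z; rewrite /qsols /= PoszM => <-; split=> //.
  by rewrite /qnorm /=; ring.
move=> [x y]; rewrite /qsols /qnorm /= PoszM => zn _.
have [k E] : exists k, x + y = 2 * k.
  have : (2 %| (x + y) * (x + y))%Z.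
    have -> : (x + y) * (x + y) =
        4%N%:Z * n%:Z + 2 * (x * y + (1 - 2 * c) * y ^+ 2) by rewrite -zn; ring.
    by rewrite rpredD // dvdz_mulr.
  by rewrite (@Euclidz 2) // orbb => /dvdzP[k ->]; exists k; rewrite mulrC.
have xE : x = 2 * k - y by lia.
exists (k, y); last by rewrite xE.
apply: (@mulfI _ 4) => //; rewrite -[4 * n%:Z]zn xE /=; ring.
Qed.

Hypothesis c_odd : ~~ (2 %| c)%Z.

(* 2 is inert: the quotient of Z[t] by 2 is the field with four elements *)
Lemma qnorm_dvd2 z : (2 %| qnorm (-1) c z)%Z = qdvd 2 z.
Proof.
rewrite /qdvd; case: z => x y /=.
have [k ck] : exists k, c = 2 * k + 1 by exists (c %/ 2)%Z; lia.
have -> : (2 %| qnorm (-1) c (x, y))%Z = (2 %| x * x + x * y + y * y)%Z.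
  have -> : qnorm (-1) c (x, y) = x * x + x * y + y * y
     + 2 * (k * y ^+ 2 - x * y) by rewrite /qnorm /= ck; ring.
  by rewrite rpredDr // dvdz_mulr.
have : x = 2 * (x %/ 2)%Z \/ x = 2 * (x %/ 2)%Z + 1 by lia.
have : y = 2 * (y %/ 2)%Z \/ y = 2 * (y %/ 2)%Z + 1 by lia.
move: (x %/ 2)%Z (y %/ 2)%Z => x' y' [->|->] [->|->]; lia.
Qed.

(** As 2 is inert, an element of even norm is divisible by 2, so its second coordinate is even. *)
Lemma card_solX_even n : ~~ odd n ->
  qsum 0 (4 * c - 1) (fun=> 1) n = qsum (-1) c (fun=> 1) n.
Proof.
move=> n2; rewrite qsum_form0_even big_mkcond /= /qsum big_seq [RHS]big_seq.
apply: eq_bigr => z; rewrite in_qsols // => /eqP zn.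
have : qdvd 2 z by rewrite -qnorm_dvd2 zn; lia.
by case/andP => _ ->.
Qed.

(* On Z[t]/2 = F_4 this is the real part (doubled) of a cubic character. *)
Definition cubic2 (z : int * int) : int :=
  if qdvd 2 z then 0 else if (2 %| z.2)%Z then 2 else -1.

(** On elements of odd norm, [1 + cubic2] is three times the indicator of an even second
    coordinate. *)
Lemma card_solX_odd n : odd n ->
  3 * qsum 0 (4 * c - 1) (fun=> 1) n =
  qsum (-1) c (fun=> 1) n + qsum (-1) c cubic2 n.
Proof.
move=> n2; rewrite qsum_form0_even big_mkcond /= /qsum big_distrr -big_split /=.
rewrite big_seq [RHS]big_seq.
apply: eq_bigr => z; rewrite in_qsols // => /eqP zn.
rewrite /cubic2; have /negbTE -> : ~~ qdvd 2 z by rewrite -qnorm_dvd2 zn; lia.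
by case: ifP => _; rewrite ?mulr1 ?mulr0.
Qed.

End HalfInteger.

(** A range of primes that does not depend on [n] turns multiplicativity into a termwise
    identity. *)
Lemma kroneckerE (a : int) n m : (0 < n)%N -> (n < m)%N ->
  kronecker a n = \prod_(q <- iota 0 m | prime q) kronecker_prime a q ^+ logn
    q n.
Proof.
move=> n0 nm; rewrite /kronecker eqz_nat eqn0Ngt n0 ltz_nat ltn0 andFb mul1r.
rewrite absz_nat [RHS](bigID (fun q => q %| n)%N) /= [X in _ = _ * X]big1
  ?mulr1.
  rewrite -[RHS]big_filter; apply: perm_big; apply: uniq_perm.
  - exact: primes_uniq.
  - by rewrite filter_uniq ?iota_uniq.
  move=> q; rewrite mem_primes mem_filter n0 mem_iota add0n /=.
  case: (boolP (q %| n)%N) => qn; rewrite ?andbF //.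
  by rewrite (leq_ltn_trans (dvdn_leq n0 qn) nm) !andbT.
by move=> q /andP[qp qn]; rewrite lognE qp n0 (negbTE qn).
Qed.

Lemma kronecker_prime_nat (a : int) p : prime p ->
  kronecker a p = kronecker_prime a p.
Proof.
move=> pp; rewrite /kronecker eqz_nat eqn0Ngt (prime_gt0 pp) ltz_nat ltn0 andFb.
by rewrite mul1r absz_nat primes_prime // big_seq1 logn_prime // eqxx expr1.
Qed.

Lemma kronecker_primeM (a : int) p n : prime p -> (0 < n)%N ->
  kronecker a (p * n)%N = kronecker a p * kronecker a n.
Proof.
move=> pp n0; have p0 := prime_gt0 pp.
rewrite !(@kroneckerE a _ (p * n).+1) ?muln_gt0 ?p0 ?n0 //.
- by rewrite -big_split; apply: eq_bigr => q _; rewrite lognM // exprD.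
- by rewrite ltnS leq_pmull.
by rewrite ltnS leq_pmulr.
Qed.

Lemma sqr_mod_existsP (a : int) p : (0 < p)%N ->
  reflect (exists t : int, (p %| t ^+ 2 - a)%Z)
    [exists x : 'I_p, ((x : nat)%:Z ^+ 2 == a %[mod p])%Z].
Proof.
move=> p0; apply: (iffP existsP) => [[x]|[t pt]].
  by rewrite eqz_mod_dvd => h; exists (x : nat)%:Z.
have r0 : 0 <= (t %% p)%Z by rewrite modz_ge0 //; lia.
have rp : (t %% p)%Z < p%:Z by rewrite ltz_pmod.
have rp' : (`|(t %% p)%Z| < p)%N by lia.
exists (Ordinal rp') => /=; rewrite gez0_abs // eqz_mod_dvd.
have -> : (t %% p)%Z ^+ 2 - a
    = (t ^+ 2 - a) - p%:Z * ((t %/ p)%Z * (2 * t - (t %/ p)%Z * p%:Z)).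
  have -> : (t %% p)%Z = t - (t %/ p)%Z * p by rewrite {2}(divz_eq t p) addrAC
    subrr add0r.
  ring.
by rewrite rpredB // dvdz_mulr.
Qed.

Lemma divisor_sum_unique b c (chi : nat -> int) (k : int) n :
  chi 1%N = 1 ->
  (forall p m, prime p -> (0 < m)%N -> chi (p * m)%N = chi p * chi m) ->
  (forall p, prime p -> hecke (qsum b c (fun=> 1)) p (1 + chi p) (chi p)) ->
  qsum b c (fun=> 1) 1 = k -> (0 < n)%N ->
  qsum b c (fun=> 1) n = k * \sum_(d <- divisors n) chi d.
Proof.
move=> chi1 chiM hS S1 n0.
apply: (@hecke_unique 1 _ (fun n => \sum_(d <- divisors n) chi d)) => //.
- move=> p pp _; exists (1 + chi p), (chi p); split; first exact: hS.
  exact: hecke_divisor_sum.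
- by rewrite big_seq1 chi1 mulr1.
by rewrite coprime1n.
Qed.

Lemma kronecker_1r (a : int) : kronecker a 1%N = 1.
Proof. by rewrite (@kroneckerE a 1 2) // big1 // => q _; rewrite logn1. Qed.

Lemma prime_dvd_pow2 p k : prime p -> (p %| (2 ^ k)%N%:Z)%Z -> p = 2%N.
Proof.
move=> pp; rewrite dvdzE /= Euclid_dvdX // dvdn_prime2 //.
by case/andP => /eqP.
Qed.

Lemma kronecker_prime_sqr (a : int) p : prime p -> p != 2%N -> ~~ (p %| a)%Z ->
  kronecker_prime a p =
    if `[< exists t : int, (p %| t ^+ 2 - a)%Z >] then 1 else -1.
Proof.
move=> pp p2 pa; rewrite /kronecker_prime (negbTE p2) (negbTE pa).
rewrite (_ : [exists x : 'I_p, _] = `[< exists t : int, (p %| t ^+ 2 - a)%Z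
  >]) //.
by apply/(sqr_mod_existsP a (prime_gt0 pp))/asboolP.
Qed.

(** Made for (a, c) = (-4, 1) and (-2, 2). Only 2 can ramify, and the last hypothesis replaces -c by
    a under the quadratic symbol at odd primes. *)
Lemma hecke_kronecker_sqr (a c : int) p : 0 < c < 3 -> prime p ->
  (2 %| a)%Z -> ((p %| 4 * c)%Z -> p = 2%N) ->
  ((p %| a)%Z -> p = 2%N) ->
  (p != 2%N -> (exists t : int, (p %| t ^+ 2 + c)%Z) <->
               (exists t : int, (p %| t ^+ 2 - a)%Z)) ->
  hecke (qsum 0 c (fun=> 1)) p (1 + kronecker a p) (kronecker a p).
Proof.
move=> c3 pp a2 pc2 pa2 pE; rewrite kronecker_prime_nat //.
have E t : qnorm 0 c (t, 1) = t ^+ 2 + c.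
  by rewrite /qnorm /= mul0r mul0r addr0 expr1n mulr1.
have ram : (p %| 0 ^+ 2 - 4 * c)%Z -> p = 2%N.
  by rewrite expr0n sub0r rpredN.
apply: hecke_qsum1 => //; first lia.
- by move=> k z; apply: euclid_form0.
- by move/ram ->; rewrite /kronecker_prime /= a2.
- move=> pD [t]; rewrite E => pt; have p2 : p != 2%N.
    by apply: contra pD => /eqP ->; rewrite expr0n sub0r rpredN dvdz_mulr.
  rewrite kronecker_prime_sqr ?asboolT //; first by apply: (proj1 (pE p2));
    exists t.
  by apply: contra p2 => /pa2 ->.
move=> pD nt; have p2 : p != 2%N.
  by apply: contra pD => /eqP ->; rewrite expr0n sub0r rpredN dvdz_mulr.
rewrite kronecker_prime_sqr ?asboolF //.
  by move/(proj2 (pE p2)) => [t pt]; apply: nt; exists t; rewrite E.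
by apply: contra p2 => /pa2 ->.
Qed.

Lemma sqr_le1 (x : int) : x ^+ 2 <= 1 -> x \in [:: 0; 1; -1].
Proof.
move=> x1; have [|[|]] : x = 0 \/ x = 1 \/ x = -1 by nia.
all: by move=> ->.
Qed.

Lemma card_solX_1_2 n : (0 < n)%N ->
  (card_of (solX n 1))%:Z = 4 * \sum_(c <- divisors n) kronecker (-4) c%:Z /\
  (card_of (solX n 2))%:Z = 2 * \sum_(c <- divisors n) kronecker (-2) c%:Z.
Proof.
move=> n0; rewrite !card_solX; split.
  apply: (divisor_sum_unique (kronecker_1r _) (@kronecker_primeM _)) => //.
    move=> p pp; apply: hecke_kronecker_sqr => //.
    - exact: (@prime_dvd_pow2 p 2).
    - by rewrite -[-4]/(- (4%N%:Z)) rpredN; apply: (@prime_dvd_pow2 p 2).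
    move=> p2; split=> [[t pt]|[t pt]].
      exists (2 * t); have -> : (2 * t) ^+ 2 - -4 = 4 * (t ^+ 2 + 1) by ring.
      exact: dvdz_mull.
    have podd : odd p by case: (even_prime pp) => // e; rewrite e in p2.
    (* t is halved modulo the odd prime p. *)
    have [x xE] : exists x : int, t = 2 * x \/ t + p%:Z = 2 * x.
      have [?|?] : t = 2 * (t %/ 2)%Z \/ t + p%:Z = 2 * ((t + p%:Z) %/ 2)%Z by
        lia.
        by exists (t %/ 2)%Z; left.
      by exists ((t + p%:Z) %/ 2)%Z; right.
    exists x; have : (p %| 4 * (x ^+ 2 + 1))%Z.
      have -> : 4 * (x ^+ 2 + 1) = (2 * x) ^+ 2 - -4 by ring.
      case: xE => <- //.
      have -> : (t + p%:Z) ^+ 2 - -4 = t ^+ 2 - -4 + p%:Z * (2 * t + p%:Z) by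
        ring.
      by rewrite rpredD // dvdz_mulr.
    rewrite Euclidz // => /orP[/(@prime_dvd_pow2 p 2) h|//].
    by rewrite h in p2.
  (* The constant 4 is the number of units of Z[i]. *)
  rewrite (@qsum_explicit _ _ _ _ [:: (1, 0); (-1, 0); (0, 1); (0, -1)]) //.
    by rewrite !big_cons big_nil.
  move=> [x y]; rewrite !inE /qnorm /= !xpair_eqE; split.
    move=> E; have : x ^+ 2 <= 1 by have := sqr_ge0 y; lia.
    have : y ^+ 2 <= 1 by have := sqr_ge0 x; lia.
    move=> /sqr_le1 + /sqr_le1; rewrite !inE => /or3P + /or3P.
    by move: E => + [] /eqP ye [] /eqP xe; rewrite xe ye.
  by do !case/orP; case/andP => /eqP -> /eqP ->.
apply: (divisor_sum_unique (kronecker_1r _) (@kronecker_primeM _)) => //.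
  move=> p pp; apply: hecke_kronecker_sqr => //.
    exact: (@prime_dvd_pow2 p 3).
  by rewrite -[-2]/(- (2%N%:Z)) rpredN; apply: (@prime_dvd_pow2 p 1).
rewrite (@qsum_explicit _ _ _ _ [:: (1, 0); (-1, 0)]) //.
  by rewrite !big_cons big_nil.
move=> [x y]; rewrite !inE /qnorm /= !xpair_eqE; split.
  move=> E; have : x ^+ 2 <= 1 by have := sqr_ge0 y; lia.
  have : y ^+ 2 <= 1 by have := sqr_ge0 x; lia.
  move=> /sqr_le1 + /sqr_le1; rewrite !inE => /or3P + /or3P.
  by move: E => + [] /eqP ye [] /eqP xe; rewrite xe ye.
by do !case/orP; case/andP => /eqP -> /eqP ->.
Qed.

(** * Prime discriminants *)

Section PrimeDisc.
Variables (c : int) (a : nat).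
Hypotheses (c0 : 0 < c) (a_prime : prime a) (aE : a%:Z = 4 * c - 1).
Notation N := (qnorm (-1) c).

Let a3 : (a %% 4 = 3)%N. Proof. by lia. Qed.

Lemma qnorm_sqr_mod u p : N u = p%:Z -> exists s : int, (a %| s ^+ 2 - p%:Z)%Z.
Proof.
move=> up; exists (2 * c * (2 * u.1 - u.2)); rewrite -up.
have -> : (2 * c * (2 * u.1 - u.2)) ^+ 2 - N u =
   a%:Z * ((4 * c + 1) * N u - 4 * c ^+ 2 * u.2 ^+ 2).
  by rewrite aE /qnorm; ring.
exact: dvdz_mulr.
Qed.

Lemma sqr_mod_root p : prime p -> odd p -> p != a ->
  (exists s : int, (a %| s ^+ 2 - p%:Z)%Z) -> exists t : int, (p %| N (t,
    1%R))%Z.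
Proof.
move=> pp podd pa [s /(sqr_mod_opp a_prime a3 pp pa)] [x px].
(* t solves 2 t - 1 = x modulo p, because 4 N(t, 1) = (2 t - 1)^2 + a. *)
have [t tE] : exists t : int, x + 1 = 2 * t \/ x + 1 + p%:Z = 2 * t.
  have [?|?] : x + 1 = 2 * ((x + 1) %/ 2)%Z \/
    x + 1 + p%:Z = 2 * ((x + 1 + p%:Z) %/ 2)%Z by lia.
    by exists ((x + 1) %/ 2)%Z; left.
  by exists ((x + 1 + p%:Z) %/ 2)%Z; right.
exists t; have : (p %| 4 * N (t, 1))%Z.
  have -> : 4 * N (t, 1) = (2 * t - 1) ^+ 2 + a%:Z by rewrite aE /qnorm /=;
    ring.
  case: tE => <-; first by rewrite addrK.
  have -> : (x + 1 + p%:Z - 1) ^+ 2 + a%:Z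
     = x ^+ 2 + a%:Z + p%:Z * (2 * x + p%:Z) by ring.
  by rewrite rpredD // dvdz_mulr.
rewrite Euclidz // => /orP[/(@prime_dvd_pow2 p 2) h|//].
by rewrite h in podd.
Qed.

Lemma disc_dvd p : prime p -> (p %| (-1) ^+ 2 - 4 * c)%Z = (p == a).
Proof.
move=> pp; have -> : (-1) ^+ 2 - 4 * c = - a%:Z by rewrite aE; ring.
by rewrite rpredN dvdzE /= dvdn_prime2.
Qed.

(** [sqr_mod_root] treats odd primes, so p = 2 is left to the caller: either 2 has a root or it is
    not a square modulo a. *)
Lemma hecke_kronecker_disc p : c < 3 -> prime p ->
  (p = 2%N -> (exists t : int, (p %| N (t, 1%R))%Z) \/
     ~ exists s : int, (a %| s ^+ 2 - p%:Z)%Z) ->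
  hecke (qsum (-1) c (fun=> 1)) p (1 + kronecker p%:Z a) (kronecker p%:Z a).
Proof.
move=> c3 pp p2; have D : (-1) ^+ 2 - 4 * c < 0 by lia.
have a2 : a != 2%N by lia.
have euc : forall (k : int) z, 0 < k -> exists v : int * int,
    N (z.1 - k * v.1, z.2 - k * v.2) < k ^+ 2.
  by move=> k z; apply: euclid_formN1; rewrite c0.
have ap : (a %| p%:Z)%Z = (p == a) by rewrite dvdzE /= dvdn_prime2 // eq_sym.
rewrite kronecker_prime_nat //.
apply: hecke_qsum1; rewrite ?disc_dvd //.
- by move/eqP => pa; rewrite /kronecker_prime (negbTE a2) pa dvdzz.
- move=> pa [t pt]; rewrite kronecker_prime_sqr ?ap // asboolT //.
  have [u up] := euclid_represents D euc pp (ex_intro _ t pt).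
  exact: qnorm_sqr_mod up.
move=> pa nt; rewrite kronecker_prime_sqr ?ap // asboolF // => hs.
have [e|podd] := even_prime pp; first by case: (p2 e).
by apply: nt; apply: sqr_mod_root.
Qed.

End PrimeDisc.

Lemma kronecker7E (t : nat) :
  kronecker t 7 = nth 0 [:: 0; 1; 1; -1; 1; -1; -1] (t %% 7).
Proof.
rewrite (kronecker_prime_nat t (p := 7)) // /kronecker_prime /=.
rewrite -[(_ %| _)%Z]/(7 %| t)%N /dvdn.
have sq : [exists x : 'I_7, ((x : nat)%:Z ^+ 2 == t%:Z %[mod 7%N])%Z] =
    (t %% 7 \in [:: 0; 1; 2; 4])%N.
  apply/existsP/idP => [[x /eqP]|].
    rewrite !inE; case: x => -[|[|[|[|[|[|[|//]]]]]]] /= _; lia.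
  rewrite !inE => /or4P[] /eqP h.
  - by exists (@Ordinal 7 0 isT); apply/eqP => /=; lia.
  - by exists (@Ordinal 7 1 isT); apply/eqP => /=; lia.
  - by exists (@Ordinal 7 3 isT); apply/eqP => /=; lia.
  by exists (@Ordinal 7 2 isT); apply/eqP => /=; lia.
rewrite sq; have : (t %% 7 < 7)%N by rewrite ltn_mod.
by case: (t %% 7)%N => [|[|[|[|[|[|[|]]]]]]].
Qed.

Lemma kronecker7M (s t : nat) :
  kronecker (s * t)%N%:Z 7 = kronecker s 7 * kronecker t 7.
Proof.
rewrite !kronecker7E -modnMm.
have : (s %% 7 < 7)%N by rewrite ltn_mod.
have : (t %% 7 < 7)%N by rewrite ltn_mod.
by case: (t %% 7)%N => [|[|[|[|[|[|[|]]]]]]] //;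
   case: (s %% 7)%N => [|[|[|[|[|[|[|]]]]]]].
Qed.

Lemma qsum_disc3 n : (0 < n)%N ->
  qsum (-1) 1 (fun=> 1) n = 6 * \sum_(c <- divisors n) kronecker c%:Z 3.
Proof.
move=> n0; apply: divisor_sum_unique => //.
- by rewrite kronecker3E.
- by move=> p m _ _; apply: kronecker3M.
- move=> p pp; apply: (@hecke_kronecker_disc 1 3) => // ->; right=> -[s].
  have : s = 3 * (s %/ 3)%Z \/ s = 3 * (s %/ 3)%Z + 1
     \/ s = 3 * (s %/ 3)%Z + 2 by lia.
  by move: (s %/ 3)%Z => k [->|[->|->]]; lia.
rewrite (@qsum_explicit _ _ _ _ [:: (1, 0); (-1, 0); (0, 1); (0, -1);
  (1, 1); (-1, -1)]) //.
  by rewrite !big_cons big_nil.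
move=> [x y]; rewrite !inE /qnorm /= !xpair_eqE; split.
  move=> E; have : x ^+ 2 <= 1 by have := sqr_ge0 (2 * y - x); lia.
  have : y ^+ 2 <= 1 by have := sqr_ge0 (2 * x - y); lia.
  move=> /sqr_le1 + /sqr_le1; rewrite !inE => /or3P + /or3P.
  by move: E => + [] /eqP ye [] /eqP xe; rewrite xe ye.
by do !case/orP; case/andP => /eqP -> /eqP ->.
Qed.

Lemma qsum_disc7 n : (0 < n)%N ->
  qsum (-1) 2 (fun=> 1) n = 2 * \sum_(c <- divisors n) kronecker c%:Z 7.
Proof.
move=> n0; apply: divisor_sum_unique => //.
- by rewrite kronecker7E.
- by move=> p m _ _; apply: kronecker7M.
(* The form takes the value c = 2 at (0, 1), so 2 has a root. *)
- by move=> p pp; apply: (@hecke_kronecker_disc 2 7) => // ->; left; exists 0.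
rewrite (@qsum_explicit _ _ _ _ [:: (1, 0); (-1, 0)]) //.
  by rewrite !big_cons big_nil.
move=> [x y]; rewrite !inE /qnorm /= !xpair_eqE; split.
  move=> E; have y0 : y ^+ 2 <= 0 by have := sqr_ge0 (2 * x - y); lia.
  have {}y0 : y = 0 by nia.
  rewrite y0 in E *; have : x ^+ 2 <= 1 by lia.
  by move=> /sqr_le1; rewrite !inE => /or3P[] /eqP xe; rewrite xe in E *.
by do !case/orP; case/andP => /eqP -> /eqP ->.
Qed.

(** Multiplication by the cube root of unity t permutes the nonzero classes modulo 2 cyclically, so
    the three values are 2, -1, -1 in some order, or all 0. *)
Lemma cubic2_omega z :
  cubic2 z + cubic2 (qmul (-1) 1 (0, 1) z)
    + cubic2 (qmul (-1) 1 (0, 1) (qmul (-1) 1 (0, 1) z)) = 0.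
Proof.
have E : qmul (-1) 1 (0, 1) z = (- z.2, z.1 - z.2).
  by rewrite /qmul /=; congr (_, _); ring.
rewrite E (_ : qmul _ _ _ _ = (z.2 - z.1, - z.1)); last first.
  by rewrite /qmul /=; congr (_, _); ring.
case: z {E} => x y; rewrite /cubic2 /qdvd /=.
have -> : (2 %| - y)%Z = (2 %| y)%Z by rewrite rpredN.
have -> : (2 %| - x)%Z = (2 %| x)%Z by rewrite rpredN.
have -> : (2 %| y - x)%Z = ((2 %| x)%Z == (2 %| y)%Z) by lia.
have -> : (2 %| x - y)%Z = ((2 %| x)%Z == (2 %| y)%Z) by lia.
by case: (2 %| x)%Z; case: (2 %| y)%Z.
Qed.

Lemma card_solX_3 n : (0 < n)%N ->
  (~~ odd n ->
     (card_of (solX n 3))%:Z = 6 * \sum_(c <- divisors n) kronecker c%:Z 3)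
  /\ (odd n ->
     (card_of (solX n 3))%:Z = 2 * \sum_(c <- divisors n) kronecker c%:Z 3).
Proof.
move=> n0; rewrite card_solX -[3%N%:Z]/(4 * 1 - 1 : int); split=> n2.
  by rewrite (card_solX_even _ _ n2) // qsum_disc3.
apply: (@mulfI _ 3) => //; rewrite card_solX_odd // qsum_disc3 //.
suff -> : qsum (-1) 1 cubic2 n = 0 by rewrite addr0 mulrA.
apply: (@mulfI _ 3) => //; rewrite mulr0.
(* Averaging over the units 1, w, w^2 kills the sum of [cubic2]. *)
pose w := (0, 1) : int * int.
have w1 : qnorm (-1) 1 w = 1 by [].
transitivity (qsum (-1) 1 (fun z => cubic2 z + cubic2 (qmul (-1) 1 w z)
    + cubic2 (qmul (-1) 1 w (qmul (-1) 1 w z))) n).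
  rewrite /qsum !big_split /= -!/(qsum _ _ _ n).
  rewrite (@qsum_unit _ _ w (fun z => cubic2 (qmul (-1) 1 w z))) //.
  by rewrite (@qsum_unit _ _ w) //; ring.
by rewrite /qsum big1 // => z _; apply: cubic2_omega.
Qed.

Lemma card_solX_7 n : (0 < n)%N ->
  [/\ (4 %| n)%N -> (card_of (solX n 7))%:Z
          = 2 * \sum_(c <- divisors (n %/ 4)) kronecker c%:Z 7,
      ~~ odd n -> ~~ (4 %| n)%N -> solX n 7 = set0 &
      odd n -> (card_of (solX n 7))%:Z
          = 2 * \sum_(c <- divisors n) kronecker c%:Z 7].
Proof.
move=> n0; rewrite card_solX -[7%N%:Z]/(4 * 2 - 1 : int); split.
- move=> n4; rewrite -{1}(divnK n4) mulnC qsum_form0_mul4 // qsum_disc7 //.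
  by rewrite divn_gt0 // dvdn_leq.
- move=> n2 n4; rewrite -subset0 => -[x y]; rewrite /solX /= => E.
  (* For even n, x and y have equal parity, and then 4 divides x^2 + 7 y^2. *)
  have : x = 2 * (x %/ 2)%Z \/ x = 2 * (x %/ 2)%Z + 1 by lia.
  have : y = 2 * (y %/ 2)%Z \/ y = 2 * (y %/ 2)%Z + 1 by lia.
  move: (x %/ 2)%Z (y %/ 2)%Z => x' y' [] ye [] xe; move: E; rewrite xe ye; lia.
move=> n2; rewrite qsum_form0_even // -qsum_disc7 // big_mkcond /= /qsum.
rewrite big_seq [RHS]big_seq; apply: eq_bigr => -[x y]; rewrite in_qsols //.
(* Here c = 2 is even: for odd n, x (x - y) is odd, which forces y to be even. *)
rewrite /qnorm /= => /eqP E; case: ifPn => // y2.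
have : x = 2 * (x %/ 2)%Z \/ x = 2 * (x %/ 2)%Z + 1 by lia.
have : y = 2 * (y %/ 2)%Z + 1 by lia.
by move: (x %/ 2)%Z (y %/ 2)%Z => x' y' ye [] xe; move: E; rewrite xe ye; lia.
Qed.

(** * Unique factorization and Heegner numbers *)

(** [ufd] speaks of nonzero nonunits, so the cases where a factor is zero or a unit come first. *)
Lemma ufd_irreducible_prime (R : idomainType) (p x y w : R) : ufd R ->
  irreducible_elt p -> x * y = p * w ->
  (exists v, x = p * v) \/ (exists v, y = p * v).
Proof.
move=> uR irr xy; have [p0 pu pirr] := irr.
have [->|x0] := eqVneq x 0; first by left; exists 0; rewrite mulr0.
have [->|y0] := eqVneq y 0; first by right; exists 0; rewrite mulr0.
have [xu|xu] := boolP (x \is a GRing.unit).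
  by right; exists (w * x^-1); rewrite mulrA -xy mulrAC divrr // mul1r.
have [yu|yu] := boolP (y \is a GRing.unit).
  by left; exists (w * y^-1); rewrite mulrA -xy -mulrA divrr // mulr1.
have [wu|wu] := boolP (w \is a GRing.unit).
  have pE : p = x * (y * w^-1) by rewrite mulrA xy -mulrA divrr // mulr1.
  case: (pirr _ _ pE); first by rewrite (negbTE xu).
  by rewrite unitrM unitrV wu andbT (negbTE yu).
have w0 : w != 0.
  by apply: contraNneq x0 => w0; move/eqP: xy;
    rewrite w0 mulr0 mulf_eq0 (negbTE y0) orbF.
have [[s [sI sE]] _] := uR x x0 xu.
have [[t [tI tE]] _] := uR y y0 yu.
have [[r [rI rE]] _] := uR w w0 wu.
have xy0 : x * y != 0 by rewrite mulf_neq0.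
have xyu : x * y \isn't a GRing.unit by rewrite unitrM negb_and xu.
(* Two factorizations of x y: by uniqueness p is associate to a member of s or of t. *)
have [_ /(_ (s ++ t) (p :: r))] := uR _ xy0 xyu.
case.
- split; last by rewrite big_cat /= -sE -tE.
  by move=> q; rewrite mem_cat => /orP[/sI|/tI].
- split; last by rewrite big_cons -rE.
  by move=> q; rewrite inE => /orP[/eqP ->|/rI].
move=> t' perm [sz ass].
have pt' : p \in t' by rewrite -(perm_mem perm) mem_head.
have ip : (index p t' < size (s ++ t))%N by rewrite sz index_mem.
have [u uu] := ass _ ip; rewrite nth_index // => pE.
have := mem_nth 0 ip; move: (_`_ _) pE => q pE.
have div (z : R) (l : seq R) : q \in l -> z = \prod_(r <- l) r ->
    exists v, z = p * v.
  move=> ql ->; rewrite (big_rem _ ql) /=;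
    exists (u^-1 * \prod_(r <- rem q l) r).
  by rewrite pE mulrACA divrr // mul1r.
by rewrite mem_cat => /orP[] h; [left; apply: div h sE|right; apply: div h tE].
Qed.

Section QuadInt.
Variables (a : nat) (b c : int).
Hypothesis omega2 : omega a ^+ 2 = b%:~R * omega a - c%:~R.
Hypothesis D : b ^+ 2 - 4 * c < 0.
Implicit Types z w : int * int.

Let eval z : algC := z.1%:~R + z.2%:~R * omega a.

Let eval_in z : eval z \in quad_int a.
Proof. by apply/quad_intP; exists z.1, z.2. Qed.

Definition of_pair z : quadInt a := QuadInt (eval_in z).

Lemma val_of_pair z : val (of_pair z) = z.1%:~R + z.2%:~R * omega a.
Proof. by []. Qed.

Lemma of_pair_surj (x : quadInt a) : exists z, x = of_pair z.
Proof.
by have /quad_intP[u [v E]] := valP x; exists (u, v); apply: val_inj.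
Qed.

Lemma of_pairM z w : of_pair (qmul b c z w) = of_pair z * of_pair w.
Proof.
apply: val_inj; rewrite [RHS]rmorphM /= /eval /qmul /=.
rewrite !rmorphD !rmorphN !rmorphM /=.
transitivity (z.1%:~R * w.1%:~R + (z.1%:~R * w.2%:~R + z.2%:~R * w.1%:~R) *
  omega a
  + z.2%:~R * w.2%:~R * (omega a ^+ 2)); last by ring.
by rewrite omega2; ring.
Qed.

Lemma of_pair_int (k : int) : of_pair (k, 0) = k%:~R.
Proof.
by apply: val_inj; rewrite [RHS]rmorph_int val_of_pair /= mul0r addr0.
Qed.

Lemma of_pair_scale k z : of_pair (qscale k z) = k%:~R * of_pair z.
Proof.
rewrite -of_pair_int -of_pairM; congr of_pair.
by rewrite /qscale /qmul /=; congr (_, _); ring.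
Qed.

Lemma of_pair_conj z : of_pair z * of_pair (qconj b z) = (qnorm b c z)%:~R.
Proof.
rewrite -of_pairM -of_pair_int; congr of_pair.
by rewrite /qmul /qconj /qnorm /=; congr (_, _); ring.
Qed.

Lemma intr_quadInt_eq0 (k : int) : (k%:~R == 0 :> quadInt a) = (k == 0).
Proof.
by rewrite -val_eqE rmorph_int rmorph0 intr_eq0.
Qed.

Lemma of_pair_eq0 z : of_pair z = 0 -> z = (0, 0).
Proof.
move=> z0; apply: (qnorm_eq0 D); apply/eqP; rewrite -intr_quadInt_eq0.
by rewrite -of_pair_conj z0 mul0r.
Qed.

Lemma of_pair_inj : injective of_pair.
Proof.
move=> z w /eqP; rewrite -subr_eq0 => /eqP e.
have : of_pair (z.1 - w.1, z.2 - w.2) = 0.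
  rewrite -[RHS]e; apply: val_inj; rewrite rmorphB /= /eval /=.
  by rewrite !rmorphB /=; ring.
move/of_pair_eq0 => [] /eqP + /eqP; rewrite !subr_eq0.
by case: (z) (w) => x y [x' y'] /= /eqP -> /eqP ->.
Qed.

Lemma of_pair_unit z : (of_pair z \is a GRing.unit) = (qnorm b c z == 1).
Proof.
apply/idP/eqP => [zu|z1]; last first.
  apply/unitrP; exists (of_pair (qconj b z)).
  by rewrite [X in X = _]mulrC of_pair_conj z1.
have [w wE] := of_pair_surj ((of_pair z)^-1).
have : of_pair (qmul b c z w) = of_pair (1, 0).
  by rewrite of_pairM -wE divrr // of_pair_int.
move/of_pair_inj/(congr1 (qnorm b c)); rewrite qnormM.
have -> : qnorm b c (1, 0) = 1 by rewrite /qnorm /=; ring.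
move/(congr1 absz)/eqP; rewrite abszM muln_eq1 => /andP[/eqP z1 _].
by rewrite -[LHS]gez0_abs ?z1 // qnorm_ge0.
Qed.

(** If p were not a norm it would be irreducible, a proper factor having norm p, and hence prime.
    But it divides the product of t + omega and its conjugate, and neither factor, their second
    coordinates being 1 and -1. *)
Lemma ufd_represents p : ufd (quadInt a) -> prime p ->
  (exists t : int, (p %| qnorm b c (t, 1%R))%Z) -> exists u, qnorm b c u = p%:Z.
Proof.
move=> uR pp [t /dvdzP[k pt]]; have p1 := prime_gt1 pp.
apply: contrapT => nu.
have irr : irreducible_elt (p%:Z%:~R : quadInt a).
  split.
  - by rewrite intr_quadInt_eq0; lia.
  - rewrite -of_pair_int of_pair_unit /qnorm /=; apply/eqP; nia.
  move=> x y; have [z ->] := of_pair_surj x; have [w ->] := of_pair_surj y.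
  rewrite -of_pair_int -of_pairM => /of_pair_inj/(congr1 (qnorm b c)).
  rewrite qnormM !of_pair_unit.
  have -> : qnorm b c (p%:Z, 0) = p%:Z ^+ 2 by rewrite /qnorm /=; ring.
  move=> E; have zd : (`|qnorm b c z| %| p ^ 2)%N.
    have -> : (p ^ 2)%N = `|p%:Z ^+ 2|%N by rewrite abszX.
    by rewrite E abszM dvdn_mulr.
  have := qnorm_ge0 D z; have := qnorm_ge0 D w => w0 z0.
  have/(dvdn_pfactor _ _ pp) [[|[|[|m]]] // _ zE] := zd.
  - by left; lia.
  - by case: nu; exists z; rewrite -[qnorm _ _ _]gez0_abs // zE expn1.
  right; have {}zE : qnorm b c z = p%:Z ^+ 2 by rewrite -[qnorm _ _ _]gez0_abs
    // zE.
  apply/eqP; apply: (@mulfI _ (p%:Z ^+ 2)); last by rewrite mulr1 [RHS]E zE.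
  by rewrite expf_neq0 //; lia.
have E : of_pair (t, 1) * of_pair (qconj b (t, 1)) = p%:Z%:~R * k%:~R.
  by rewrite of_pair_conj pt rmorphM mulrC.
have nd z : z.2 = 1 \/ z.2 = -1 -> ~ exists v, of_pair z = p%:Z%:~R * v.
  move=> z2 [v]; have [w ->] := of_pair_surj v.
  rewrite -of_pair_scale => /of_pair_inj zE.
  have : (p %| z.2)%Z by rewrite zE dvdz_mulr.
  by case: z2 => ->; rewrite ?rpredN dvdz1 absz_nat; lia.
by case: (ufd_irreducible_prime uR irr E) => /nd; apply => /=; [left|right].
Qed.

End QuadInt.

Lemma omega_sqr3 a c : a%:Z = 4 * c - 1 ->
  omega a ^+ 2 = (-1)%:~R * omega a - c%:~R.
Proof.
move=> ac; have a3 : (a %% 4 == 3)%N by lia.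
rewrite /omega a3; have := sqr_sqrt_opp a; set r := sqrt_opp a => r2.
have r2' : r ^+ 2 = 1 - 4 * c%:~R.
  by rewrite r2 -[a%:R]/(a%:Z%:~R) ac rmorphB rmorphM /=; ring.
rewrite expr_div_n sqrrD r2' rmorphN /= rmorph1; by field.
Qed.

Lemma omega_sqr0 a : (a %% 4 != 3)%N ->
  omega a ^+ 2 = 0%:~R * omega a - a%:Z%:~R.
Proof.
by move=> a3; rewrite /omega (negbTE a3) sqr_sqrt_opp mul0r add0r.
Qed.

Lemma card_solY n a c : a%:Z = 4 * c - 1 -> 0 < c ->
  (card_of (solY n a))%:Z = qsum (-1) c (fun=> 1) n.
Proof.
move=> ac c0; have D : (-1) ^+ 2 - 4 * c < 0 by lia.
have om := omega_sqr3 ac.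
have a3 : (a %% 4 == 3)%N by lia.
have real_rat (r : rat) : ratr r \is @Num.real algC.
  by apply: Creal_Crat; exact: Crat_rat.
have inj := of_pair_inj om D.
rewrite card_ofE /qsum;
  apply: (@sum_fset_set_reindex _ _ _ _ _ predT (@of_pair a) (fun=> 1)).
- exact: finite_qsols.
- by apply: finite_solY; lia.
- by move=> z w _ _ /inj.
- move=> z zn; split=> //.
  exists (z.1%:~R - z.2%:~R / 2), (z.2%:~R / 2); split.
    rewrite val_of_pair /omega a3 rmorphB /= !fmorph_div /= !ratr_int ratr_nat.
    by field.
  have := congr1 (intr : int -> rat) zn; rewrite /= -[n%:Z%:~R]/(n%:R) => <-.
  have -> : (a%:R : rat) = 4 * c%:~R - 1.
    by rewrite -[a%:R]/(a%:Z%:~R) ac rmorphB rmorphM.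
  rewrite /qnorm !rmorphD !rmorphM !rmorphN /= rmorph1; by field.
move=> x [x1 [x2 [xE nE]]] _; have [z zE] := of_pair_surj x; exists z => //.
rewrite /qsols /=; apply: (@intr_inj algC).
have := sqr_norm_sqrt_opp a (real_rat x1) (real_rat x2).
rewrite -xE zE val_of_pair /omega a3.
have -> : z.1%:~R + z.2%:~R * ((-1 + sqrt_opp a) / 2) =
   (z.1%:~R - z.2%:~R / 2) + z.2%:~R / 2 * sqrt_opp a :> algC by field.
rewrite sqr_norm_sqrt_opp ?rpredM ?rpredB ?rpredM ?rpredV ?realz ?realn //.
have -> : ratr x1 ^+ 2 + a%:R * ratr x2 ^+ 2 = n%:R :> algC.
  by rewrite -!rmorphXn /= -(ratr_nat _ a) -rmorphM -rmorphD /= nE ratr_nat.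
move=> E; rewrite -[n%:Z%:~R]/(n%:R) -E.
have -> : (a%:R : algC) = 4 * c%:~R - 1.
  by rewrite -[a%:R]/(a%:Z%:~R) ac rmorphB rmorphM.
rewrite /qnorm !rmorphD !rmorphM !rmorphN /= rmorph1; by field.
Qed.

Lemma sqr_neq2 (x : int) : x ^+ 2 <> 2.
Proof.
have [x1|x1] : `|x| <= 1 \/ 2 <= `|x| by lia.
  by nia.
by nia.
Qed.

Lemma heegner_disc a : heegner a -> (11 <= a)%N ->
  exists2 c : int, a%:Z = 4 * c - 1 & prime a /\ ~~ (2 %| c)%Z.
Proof.
move=> [a0 _ uR] a11.
have a3 : (a %% 4 = 3)%N.
  (* Otherwise 2 divides N(a, 1) = a (a + 1), so 2 would be of the form x^2 + a y^2 with a >= 11. *)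
  apply/eqP; apply: contraT => a3; have om := omega_sqr0 a3.
  have D : 0 ^+ 2 - 4 * a%:Z < 0 by lia.
  have [|[x y]] := ufd_represents om D uR (isT : prime 2).
    exists a%:Z; have -> : qnorm 0 a (a%:Z, 1) = a%:Z * (a%:Z + 1).
      by rewrite /qnorm /=; ring.
    rewrite Euclidz //; lia.
  rewrite /qnorm /= mul0r mul0r addr0 => E.
  have y0 : y = 0 by nia.
  by case: (@sqr_neq2 x); rewrite -[RHS]E y0 expr0n /= mulr0 addr0.
have [c ac] : exists c, a%:Z = 4 * c - 1 by exists ((a%:Z + 1) %/ 4)%Z; lia.
have D : (-1) ^+ 2 - 4 * c < 0 by lia.
have rep := ufd_represents (omega_sqr3 ac) D uR.
have E4 x y : 4 * qnorm (-1) c (x, y) = (2 * x - y) ^+ 2 + a%:Z * y ^+ 2.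
  by rewrite ac /qnorm /=; ring.
exists c => //; split.
  (* The least prime factor p of a composite a = m p is ramified, hence a norm: 4 p = (2 x - y)^2 +
     a y^2. Then y != 0, since p is not a square, so a <= 4 p and p <= m <= 4. *)
  apply/negPn/negP => na; have a1 : (1 < a)%N by lia.
  have pp := pdiv_prime a1; set p := pdiv a in pp; have p1 := prime_gt1 pp.
  have /dvdnP[m am] : (p %| a)%N by exact: pdiv_dvd.
  have m1 : m != 1%N.
    by apply: contra na => /eqP m1; rewrite am m1 mul1n.
  have pm : (p <= m)%N.
    apply: pdiv_min_dvd; first by lia.
    by rewrite am dvdn_mulr.
  have [|[x y]] := rep p pp.
    apply: ramified_root => //; have -> : (-1) ^+ 2 - 4 * c = - a%:Z by lia.
    by rewrite rpredN dvdzE /= am dvdn_mull.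
  move/(congr1 ( *%R 4)); rewrite E4 => E.
  have [y0|y0] := eqVneq y 0.
    have xx : x ^+ 2 = p%:Z by move: E; rewrite y0; lia.
    have : (p %| x * x)%Z by rewrite -expr2 xx dvdzz.
    rewrite Euclidz // orbb => /dvdzP[k xk]; move: xx; rewrite xk exprMn.
    rewrite [p%:Z ^+ 2]expr2 mulrA -[RHS]mul1r => /mulIf h.
    have {}h : k ^+ 2 * p%:Z = 1 by apply: h; lia.
    have : (p%:Z %| 1%R)%Z by rewrite -h dvdz_mull.
    by rewrite dvdz1 absz_nat; lia.
  have y1 : 1 <= y ^+ 2 by rewrite -gtz0_ge1 exprn_even_gt0.
  have ay : a%:Z <= a%:Z * y ^+ 2 by rewrite ler_peMr.
  have m4 : (m <= 4)%N.
    rewrite -(@leq_pmul2r p) ?prime_gt0 // -am -lez_nat PoszM -E.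
    by rewrite (le_trans ay) // lerDr sqr_ge0.
  (* m = 4 contradicts a = 3 mod 4, and m <= 3 leaves a <= 9. *)
  have : (m * p < 11)%N.
    have : m = 2%N \/ m = 3%N \/ m = 4%N by lia.
    case=> [|[]] me; rewrite me in am pm *.
    - by lia.
    - by lia.
    by lia.
  by rewrite -am; lia.
(* If c = N(0, 1) is even, then 2 is a norm and 8 = (2 x - y)^2 + a y^2, which forces x^2 = 2. *)
apply/negP => c2; have [|[x y]] := rep 2%N isT.
  by exists 0; have -> : qnorm (-1) c (0, 1) = c by rewrite /qnorm /=; ring.
move/(congr1 ( *%R 4)); rewrite E4 => E.
have y0 : y = 0 by have := sqr_ge0 (2 * x - y); nia.
by case: (@sqr_neq2 x); move: E; rewrite y0; lia.
Qed.

Section Cubic2.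
Variable c : int.
Hypothesis c_odd : ~~ (2 %| c)%Z.

Let dvd2D (x y : int) : (2 %| x + y)%Z = ((2 %| x)%Z == (2 %| y)%Z).
Proof. lia. Qed.

Let dvd2M (x y : int) : (2 %| x * y)%Z = (2 %| x)%Z || (2 %| y)%Z.
Proof. exact: (@Euclidz 2). Qed.

Let dvd2N (x : int) : (2 %| - x)%Z = (2 %| x)%Z.
Proof. by rewrite rpredN. Qed.

Let dvd21 : (2 %| 1%R)%Z = false. Proof. by []. Qed.

(** [cubic2] is psi plus its complex conjugate for a cubic character psi of F_4, and psi takes
    conjugate values at u and conj(u). The factor on the right is the value of [cubic2] at u. *)
Lemma cubic2_split u z : cubic2 (qmul (-1) c u z) +
  cubic2 (qmul (-1) c (qconj (-1) u) z) =
  (if qdvd 2 u then 0 else if (2 %| u.2)%Z then 2 else -1) * cubic2 z.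
Proof.
rewrite /cubic2 /qdvd /qmul /qconj /= !(dvd2D, dvd2M, dvd2N, dvd21) (negbTE
  c_odd).
by case: (2 %| u.1)%Z; case: (2 %| u.2)%Z; case: (2 %| z.1)%Z;
  case: (2 %| z.2)%Z.
Qed.

Lemma cubic2_scale k z : ~~ (2 %| k)%Z -> cubic2 (qscale k z) = cubic2 z.
Proof. by move=> /negbTE k2; rewrite /cubic2 /qdvd /= !dvd2M k2. Qed.

(** 1 + 2 t, a square root of the discriminant 1 - 4 c, is 1 modulo 2. *)
Lemma cubic2_ramified z : cubic2 (qmul (-1) c (1, 2) z) = cubic2 z.
Proof.
rewrite /cubic2 /qdvd /qmul /= !(dvd2D, dvd2M, dvd2N, dvd21, dvdzz) (negbTE
  c_odd).
by case: (2 %| z.1)%Z; case: (2 %| z.2)%Z.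
Qed.

End Cubic2.

Lemma rat_formula (x r g k : int) (t : nat) : (0 < t)%N ->
  3 * x = r + g -> t%:Z * g = 2 * k * r ->
  x%:~R = 1 / 3 * (1 + 2 * (k%:~R / t%:R)) * r%:~R :> rat.
Proof.
move=> t0 E1 E2; have t0' : (t%:R : rat) != 0 by rewrite pnatr_eq0; lia.
have {}E1 : 3 * x%:~R = r%:~R + g%:~R :> rat.
  by rewrite -rmorphD -E1 rmorphM.
have {}E2 : t%:R * g%:~R = 2 * k%:~R * r%:~R :> rat.
  by have := congr1 (intr : int -> rat) E2; rewrite !rmorphM.
apply: (mulfI t0'); apply: (@mulfI _ 3) => //.
rewrite mulrCA E1 mulrDr E2; by field.
Qed.

Lemma card_solX_heegner n a : (0 < n)%N -> heegner a -> (11 <= a)%N ->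
  (~~ odd n -> card_of (solX n a) = card_of (solY n a))
  /\ (odd n ->
        let t := tau n`_(nonrep_residues a) in
        (card_of (solX n a))%:R
          = 1 / 3 * (1 + 2 * ((kronecker t%:Z 3)%:~R / t%:R))
            * (card_of (solY n a))%:R :> rat).
Proof.
move=> n0 ha a11; have [c ac [pa c2]] := heegner_disc ha a11.
have [_ _ uR] := ha.
have D : (-1) ^+ 2 - 4 * c < 0 by lia.
have c0 : 0 < c by lia.
have rep := ufd_represents (omega_sqr3 ac) D uR.
split=> n2.
  apply/eqP; rewrite -eqz_nat; apply/eqP.
  by rewrite card_solX (card_solY _ ac) // ac card_solX_even.
move=> t; rewrite -![(card_of _)%:R]/((card_of _)%:Z%:~R).
rewrite card_solX (card_solY _ ac) // ac.
apply: (rat_formula (g := qsum (-1) c cubic2 n)).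
- by apply: tau_gt0; exact: part_gt0.
- exact: card_solX_odd.
apply: (@hecke_cubic_formula 2) => //; last by rewrite coprime2n.
- move=> p pp; rewrite coprime2n => podd.
  have scale z : cubic2 (qscale p z) = cubic2 z by apply: cubic2_scale; lia.
  (* The prime a is ramified and, not being coprime to itself, lies outside [nonrep_residues a]. *)
  have [pea|pa'] := eqVneq p a.
    rewrite ifF; last first.
      apply/negbTE/negP => /asboolP[[]]; rewrite pea /coprime gcdnn => /eqP.
      by lia.
    have up : qnorm (-1) c (1, 2) = p%:Z by rewrite pea ac /qnorm /=; ring.
    have pD : (p %| (-1) ^+ 2 - 4 * c)%Z by rewrite (disc_dvd pa ac) // pea.
    exists 1, 0; split; first exact: (hecke_ramified D pp up).
    by apply: (hecke_ramified D pp up) => // z; apply: cubic2_ramified.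
  have pD : ~~ (p %| (-1) ^+ 2 - 4 * c)%Z by rewrite (disc_dvd pa ac).
  have solE : solX p a = set0 <->
      forall u, qnorm (-1) c u = p%:Z -> ~~ (2 %| u.2)%Z.
    split=> [X0 [x y] up|H].
      apply/negP => /dvdzP[y' /= yE]; have : solX p a (x - y', y').
        by rewrite /solX /= -up ac yE /qnorm /=; ring.
      by rewrite X0.
    rewrite -subset0 => -[x y]; rewrite /solX /= => E.
    have /H/negP[] : qnorm (-1) c (x + y, 2 * y) = p%:Z.
      by rewrite -E ac /qnorm /=; ring.
    exact: dvdz_mulr.
  have resE : power_residue 2 a p <-> exists s : int, (a %| s ^+ 2 - p%:Z)%Z.
    split=> [[_ [x]]|[s sa]].
      move=> /eqP h; exists x%:Z; rewrite -eqz_mod_dvd.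
      by rewrite -[x%:Z ^+ 2]/((x ^ 2)%N%:Z) !modz_nat eqz_nat.
    split; first by rewrite prime_coprime // dvdn_prime2 // eq_sym.
    exists `|s|%N; apply/eqP; rewrite -abszX -eqz_nat -!modz_nat.
    by rewrite eqz_mod_dvd gez0_abs ?sqr_ge0.
  have [hs|hs] := pselect (exists s : int, (a %| s ^+ 2 - p%:Z)%Z).
    have [u up] := rep p pp (sqr_mod_root c0 pa ac pp podd pa' hs).
    have u2 : qdvd 2 u = false by rewrite -(qnorm_dvd2 c0 c2) up; lia.
    have hr : hecke (qsum (-1) c (fun=> 1)) p 2 1.
      by apply: (hecke_split D pp up).
    (* If p is not of the form x^2 + a y^2, every element of norm p has odd second coordinate and
       the eigenvalue is -1; otherwise one with even second coordinate gives 2. *)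
    case: ifP => [/asboolP[_ /solE h]|ppi].
      split=> //; apply: (hecke_split D pp up) => // z.
      by rewrite cubic2_split // u2 (negbTE (h u up)).
    have [v vp v2] : exists2 v, qnorm (-1) c v = p%:Z & (2 %| v.2)%Z.
      apply: contrapT => nv; move/negP: ppi; apply; apply/asboolP; split.
        exact/resE.
      by apply/solE => v vp; apply/negP => v2; apply: nv; exists v.
    have v2' : qdvd 2 v = false by rewrite -(qnorm_dvd2 c0 c2) vp; lia.
    exists 2, 1; split=> //; apply: (hecke_split D pp vp) => // z.
    by rewrite cubic2_split // v2' v2.
  rewrite ifF; last by apply/negbTE/negP => /asboolP[/resE].
  (* A root would make p a norm, hence a square modulo a. *)
  have inert z : (p %| qnorm (-1) c z)%Z -> qdvd p z.
    apply: no_root_inert => // s; apply/negP => ps; apply: hs.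
    by have [u /(qnorm_sqr_mod ac)] := rep p pp (ex_intro _ s ps).
  by exists 0, (-1); split; apply: hecke_inert.
(* The elements of norm 1 are the units 1 and -1, where [cubic2] is 2. *)
rewrite /qsum big_distrr /= big_seq [RHS]big_seq; apply: eq_bigr => -[x y].
rewrite in_qsols // => /eqP E;
  have {E} E : (2 * x - y) ^+ 2 + a%:Z * y ^+ 2 = 4.
  by rewrite -[4]mulr1 -[X in 4 * X]E ac /qnorm /=; ring.
have y0 : y = 0 by have := sqr_ge0 (2 * x - y); nia.
have : x ^+ 2 <= 1 by move: E; rewrite y0; lia.
move/sqr_le1; rewrite !inE => /or3P[] /eqP xE; move: E; rewrite xE y0 //.
by rewrite mulr0 subrr expr0n /= mulr0 addr0.
Qed.

(** * Cubic Jacobi sums and x^2 + 27 y^2 *)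

Section JacobiSum.
Variable p : nat.
Hypotheses (p_prime : prime p) (p1 : (p %% 3 = 1)%N).

Notation w := (omega 3).
Notation F := 'F_p.

Let w2 : w ^+ 2 = - w - 1.
Proof. by rewrite (@omega_sqr3 3 1) // rmorphN rmorph1 mulN1r. Qed.

Let w3 : w ^+ 3 = 1.
Proof. by rewrite exprS w2 mulrBr mulrN -expr2 w2; ring. Qed.

Let w_int : w \in quad_int 3.
Proof. by apply/quad_intP; exists 0, 1; rewrite mul1r add0r. Qed.

Let wP (A B A' B' : int) : A%:~R + B%:~R * w = A'%:~R + B'%:~R * w ->
  A = A' /\ B = B'.
Proof.
move=> E; have inj := @of_pair_inj 3 (-1) 1 (@omega_sqr3 3 1 erefl) isT.
have /inj[-> ->] // : of_pair 3 (A, B) = of_pair 3 (A', B').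
exact: val_inj.
Qed.

Let w_neq1 : w != 1.
Proof.
apply/eqP => w1; have [] // := @wP 1 0 0 1.
by rewrite mul0r addr0 mul1r add0r w1.
Qed.

Let n := p.-1.

Let n_gt0 : (0 < n)%N.
Proof. by have := prime_gt1 p_prime; rewrite /n; lia. Qed.

Let n3 : (3 %| n)%N.
Proof. by have := prime_gt1 p_prime; rewrite /n; lia. Qed.

Let ex_generator : exists g : F, n.-primitive_root g.
Proof.
pose rs := [seq x <- enum F | x != 0].
have : has n.-primitive_root rs.
  apply: has_prim_root => //.
  - apply/allP => x; rewrite mem_filter => /andP[x0 _]; apply/unity_rootP.
    apply: (mulfI x0); rewrite mulr1 -exprS /n prednK ?prime_gt0 //.
    by have := expf_card x; rewrite card_Fp.
  - by rewrite filter_uniq ?enum_uniq.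
  rewrite size_filter /n -{1}(card_Fp p_prime) (cardD1 (0 : F)) inE add1n /=.
  by rewrite cardE -size_filter /enum_mem -filter_predI size_filter leq_eqVlt;
     apply/orP; left; apply/eqP/eq_count => x /=; rewrite !inE andbT.
by case/hasP => g _ gp; exists g.
Qed.

Let g := projT1 (cid ex_generator).

Let gP : n.-primitive_root g. Proof. exact: projT2 (cid ex_generator). Qed.

(** A cubic character, read off the discrete logarithm to base [g]; it is well defined because 3
    divides p - 1. *)
Let chi (x : F) : algC :=
  if [pick i : 'I_n | x == g ^+ i] is Some i then w ^+ i else 0.

Let chiX i : chi (g ^+ i) = w ^+ i.
Proof.
rewrite /chi; case: pickP => [j|/(_ (Ordinal (ltn_pmod i n_gt0)))] /=.
  rewrite (eq_prim_root_expr gP) => /eqP ij.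
  by rewrite -(expr_mod i w3) -(expr_mod j w3) -(modn_dvdm i n3) ij modn_dvdm.
by rewrite (prim_expr_mod gP) eqxx.
Qed.

Let g_neq0 : g != 0.
Proof.
apply/eqP => g0; have := prim_expr_order gP; rewrite g0 expr0n.
by rewrite eqn0Ngt n_gt0 /= => /eqP; rewrite eq_sym oner_eq0.
Qed.

Let chi0 : chi 0 = 0.
Proof.
rewrite /chi; case: pickP => // i /eqP e.
by have := expf_neq0 i g_neq0; rewrite -e eqxx.
Qed.

Let logP (x : F) : x != 0 -> exists i, x = g ^+ i.
Proof.
move=> x0; have xn : x ^+ n = 1.
  apply: (mulfI x0); rewrite mulr1 -exprS /n prednK ?prime_gt0 //.
  by have := expf_card x; rewrite card_Fp.
by have [i ->] := prim_rootP gP xn; exists i.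
Qed.

Let chiM x y : chi (x * y) = chi x * chi y.
Proof.
have [->|/logP[i ->]] := eqVneq x 0; first by rewrite mul0r chi0 mul0r.
have [->|/logP[j ->]] := eqVneq y 0; first by rewrite mulr0 chi0 mulr0.
by rewrite -exprD !chiX exprD.
Qed.

Let chi1 : chi 1 = 1. Proof. by rewrite -[1 in LHS](expr0 g) chiX. Qed.

Let chi_cube x : x != 0 -> chi (x ^+ 3) = 1.
Proof. by move=> /logP[i ->]; rewrite -exprM chiX mulnC exprM w3 expr1n. Qed.

Let chiP x : x != 0 -> [\/ chi x = 1, chi x = w | chi x = - w - 1].
Proof.
move=> /logP[i ->]; rewrite chiX -(expr_mod i w3) -w2.
have : (i %% 3 < 3)%N by rewrite ltn_mod.
by case: (i %% 3)%N => [|[|[|]]] // _;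
  [constructor 1|constructor 2|constructor 3].
Qed.

Let chi_int x : chi x \in quad_int 3.
Proof.
have [->|/chiP[] ->] := eqVneq x 0; rewrite ?chi0 ?rpred0 ?rpred1 //.
by rewrite rpredB ?rpredN ?rpred1.
Qed.

Let chi_cubeP x : x != 0 -> chi x = 1 -> exists y, x = y ^+ 3.
Proof.
move=> /logP[i ->]; rewrite chiX -(expr_mod i w3) => wi.
have i3 : (i %% 3 = 0)%N.
  have : (i %% 3 < 3)%N by rewrite ltn_mod.
  move: wi; case: (i %% 3)%N => [|[|[|]]] //; rewrite ?expr1 => wi _.
    by case/negP: w_neq1; rewrite wi.
  by move: w3; rewrite exprS wi mulr1 => w1; case/negP: w_neq1; rewrite w1.
by exists (g ^+ (i %/ 3)); rewrite -exprM; congr (_ ^+ _); lia.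
Qed.

Let sum_chi : \sum_x chi x = 0.
Proof.
have chig : chi g = w by rewrite -[g]expr1 chiX expr1.
have : \sum_x chi x = w * \sum_x chi x.
  rewrite {1}(reindex_inj (mulfI g_neq0)) big_distrr /=.
  by apply: eq_bigr => x _; rewrite chiM chig.
move/eqP; rewrite -subr_eq0 -{1}[\sum_x chi x]mul1r -mulrBl mulf_eq0 subr_eq0.
by rewrite eq_sym (negbTE w_neq1) => /eqP.
Qed.

Let conj_w : w^* = - w - 1.
Proof.
have nw : `|w| = 1.
  apply/eqP; rewrite -(@pexpr_eq1 _ _ 3) // -normrX w3 normr1 //.
have w0 : w != 0 by rewrite -normr_eq0 nw oner_eq0.
by apply: (mulfI w0); rewrite -normCK nw expr1n mulrBr mulrN -expr2 w2; ring.
Qed.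

Let conj_chi x : (chi x)^* = chi (x ^+ 2).
Proof.
rewrite expr2 chiM.
have [->|/chiP[] ->] := eqVneq x 0; rewrite ?chi0 ?rmorph0 ?mulr0 //.
- by rewrite rmorph1 mulr1.
- by rewrite conj_w -expr2 w2.
rewrite rmorphB rmorphN rmorph1 /= conj_w -expr2.
have -> : (- w - 1) ^+ 2 = w ^+ 2 + 2 * w + 1 by ring.
by rewrite w2; ring.
Qed.

Let sum_chi2 : \sum_x chi (x ^+ 2) = 0.
Proof.
under eq_bigr do rewrite -conj_chi.
by rewrite -rmorph_sum /= sum_chi rmorph0.
Qed.

Let sum_chi_affine (s t : F) : s != 0 -> \sum_x chi (s * x + t) = 0.
Proof.
move=> s0; rewrite -[RHS]sum_chi [RHS](reindex_inj (addIr t)) /=.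
by rewrite [RHS](reindex_inj (mulfI s0)).
Qed.

Let J := \sum_x chi (x * (1 - x)).

(** With y = 1 - u and u = 1 / v, the argument becomes ((1 - t) v + t) / v^3, and cubes do not
    change [chi]. The affine sum over all v is 0 or p; the excluded v = 0 contributes chi t. *)
Let fiber_sum t : \sum_y chi ((1 - t * y) * (1 - y) ^+ 2) =
  (if t == 1 then p%:R else 0) - chi t.
Proof.
transitivity (\sum_u chi ((1 - t + t * u) * u ^+ 2)).
  rewrite [RHS](reindex_inj (can_inj (subKr 1))) /=.
  by apply: eq_bigr => y _; congr (chi _); ring.
rewrite (bigD1 0) //= expr0n /= mulr0 chi0 add0r.
transitivity (\sum_(v | v != 0) chi ((1 - t) * v + t)).
  rewrite (reindex_inj (@invr_inj F)) /=; apply: eq_big => v;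
    first by rewrite invr_eq0.
  rewrite invr_eq0 => v0; rewrite -[LHS]mulr1 -(chi_cube v0) -chiM;
    congr (chi _).
  by field.
apply/eqP; rewrite eq_sym subr_eq; apply/eqP.
transitivity (\sum_v chi ((1 - t) * v + t)); last first.
  by rewrite (bigD1 0) //= mulr0 add0r addrC.
symmetry.
case: eqVneq => [->|t1]; last by rewrite sum_chi_affine // subr_eq0 eq_sym.
under eq_bigr do rewrite subrr mul0r add0r chi1.
by rewrite sumr_const card_Fp.
Qed.

(** Substituting x = t y in the double sum leaves the sum of chi t (p [t = 1] - chi t - 1) by
    [fiber_sum], the -1 removing y = 0; the sums of chi and of its square vanish. *)
Let jacobi_norm : J * J^* = p%:R.
Proof.
have -> : J^* = \sum_y chi ((y * (1 - y)) ^+ 2).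
  by rewrite rmorph_sum; apply: eq_bigr => y _; rewrite -conj_chi.
rewrite mulrC big_distrl /= (bigD1 0) //= mul0r expr0n /= chi0 mul0r add0r.
transitivity (\sum_(y : F | y != 0) \sum_t chi t * chi ((1 - t * y) * (1 - y)
  ^+ 2)).
  apply: eq_bigr => y y0; rewrite /J (reindex_inj (mulIf y0)) big_distrr /=.
  apply: eq_bigr => t _; rewrite -!chiM -[LHS]mul1r.
  rewrite -[RHS]mul1r -{2}(chi_cube y0) mul1r -chiM; congr (chi _); ring.
rewrite exchange_big /=.
transitivity (\sum_t chi t * ((if t == 1 then p%:R else 0) - chi t - 1)).
  apply: eq_bigr => t _; rewrite -big_distrr -fiber_sum /=; congr (_ * _).
  rewrite [in RHS](bigD1 0) //= mulr0 !subr0 expr1n mulr1 chi1.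
  by rewrite [RHS]addrAC subrr add0r.
under eq_bigr do rewrite mulrBr mulr1 mulrBr -chiM -expr2.
rewrite !sumrB sum_chi sum_chi2 !subr0 (bigD1 1) //= ?eqxx chi1 mul1r.
by rewrite big1 ?addr0 // => t /negbTE ->; rewrite mulr0.
Qed.

(** The sum of (chi x - 1) (chi (1 - x) - 1) is J + p. Its terms vanish at x = 0 and 1 and are
    otherwise multiples of (w - 1)^2 = -3 w. *)
Let jacobi_mod3 : exists2 z, z \in quad_int 3 & J = - p%:R + 3 * z.
Proof.
have key x : x != 0 -> 1 - x != 0 ->
    exists2 z, z \in quad_int 3 & (chi x - 1) * (chi (1 - x) - 1) = 3 * z.
  have w2' : w * w = - w - 1 by rewrite -expr2.
  move=> /chiP + /chiP; case=> -> [] ->.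
  - by exists 0; rewrite ?rpred0 // subrr !mul0r mulr0.
  - by exists 0; rewrite ?rpred0 // subrr !mul0r mulr0.
  - by exists 0; rewrite ?rpred0 // subrr !mul0r mulr0.
  - by exists 0; rewrite ?rpred0 // subrr !mulr0.
  - exists (- w); rewrite ?rpredN //.
    transitivity (w ^+ 2 - 2 * w + 1); [ring|rewrite w2; ring].
  - exists 1; rewrite ?rpred1 //.
    transitivity (- w ^+ 2 - w + 2); [ring|rewrite w2; ring].
  - by exists 0; rewrite ?rpred0 // subrr !mulr0.
  - exists 1; rewrite ?rpred1 //.
    transitivity (- w ^+ 2 - w + 2); [ring|rewrite w2; ring].
  exists (w + 1); rewrite ?rpredD ?rpred1 //.
  transitivity (w ^+ 2 + 4 * w + 4); [ring|rewrite w2; ring].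
have [z zint E] : exists2 z, z \in quad_int 3 &
   \sum_(x : F | (x != 0) && (1 - x != 0)) (chi x - 1) * (chi (1 - x) - 1) = 3
     * z.
  elim/big_ind: _ => [|x y [z zi ->] [z' zi' ->]|x /andP[x0 x1]].
  - by exists 0; rewrite ?rpred0 ?mulr0.
  - by exists (z + z'); rewrite ?rpredD // mulrDr.
  exact: key.
exists z => //; rewrite -E.
have tot : \sum_(x : F) (chi x - 1) * (chi (1 - x) - 1) = J + p%:R.
  transitivity (\sum_(x : F) (chi (x * (1 - x)) - chi x - chi (1 - x) + 1)).
    by apply: eq_bigr => x _; rewrite chiM; ring.
  rewrite big_split /= !sumrB sum_chi sumr_const card_Fp //.
  have -> : \sum_x chi (1 - x) = 0.
    by rewrite -[RHS]sum_chi [RHS](reindex_inj (can_inj (subKr 1))).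
  by rewrite !subr0.
rewrite (bigID (fun x : F => (x != 0) && (1 - x != 0))) /= in tot.
have rest : \sum_(x : F | ~~ ((x != 0) && (1 - x != 0)))
    (chi x - 1) * (chi (1 - x) - 1) = 0.
  rewrite big1 // => x; rewrite negb_and !negbK => /orP[] /eqP x0.
    by rewrite x0 subr0 chi1 subrr mulr0.
  have -> : x = 1 by apply/eqP; rewrite eq_sym -subr_eq0 x0.
  by rewrite chi1 subrr mul0r.
by rewrite -[J](addrK p%:R) -tot rest addr0 addrC.
Qed.

Let jacobi_mod2 : exists2 z, z \in quad_int 3 & J = chi 2%:R + 2 * z.
Proof.
have two : (2%:R : F) != 0.
  rewrite -(dvdn_pcharf (pchar_Fp p_prime)); apply/negP => /dvdn_leq.
  by have := prime_gt1 p_prime; lia.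
pose f x := chi (x * (1 - x)).
have fC x : f (1 - x) = f x by rewrite /f subKr mulrC.
(* [lt] selects one element from each pair {x, 1 - x} with x != 1 / 2. *)
pose lt (x : F) := (val x < val (1 - x)%R)%N.
exists (\sum_(x | lt x) f x); first by apply: rpred_sum => x _; apply: chi_int.
(* The fixed point 1 / 2 contributes chi (1 / 4) = chi (8 / 4) = chi 2. *)
rewrite /J -/f (bigD1 (2%:R)^-1) //=; congr (_ + _).
  rewrite -[LHS]mulr1 -(chi_cube two) -chiM; congr (chi _).
  by field.
have half (x : F) : x != 2%:R^-1 -> x != 1 - x.
  apply: contraNneq => e; rewrite -[x](mulKf two) mulr_natl [x *+ 2]mulr2n {2}e.
  by rewrite addrC subrK mulr1.
rewrite (bigID lt) /= mulr_natl mulr2n; congr (_ + _).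
  apply: eq_bigl => x; rewrite andb_idl // => h; apply: contraTneq h => ->.
  rewrite /lt (_ : 1 - _ = 2%:R^-1) ?ltnn //.
  by field.
rewrite (reindex_inj (can_inj (subKr 1))) /=; apply: eq_big => [x|x _];
  last exact: fC.
rewrite /lt subKr -leqNgt leq_eqVlt.
have [->|x2] := eqVneq x 2%:R^-1.
  rewrite (_ : 1 - _ = 2%:R^-1) ?eqxx ?ltnn //.
  by field.
have x2'' : 1 - x != 2%:R^-1.
  apply: contra x2 => /eqP e; rewrite -(subKr 1 x) e; apply/eqP; by field.
have x2' := half _ x2''.
have /negbTE -> : val x != val (1 - x).
  by apply: contra x2' => /eqP/val_inj e; rewrite subKr -e.
by rewrite x2''.
Qed.

(** A + B w is the Jacobi sum. Modulo 2 it is chi 2, one of 1, w, -w - 1, whose w-coefficient is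
    even only for 1, that is, when 2 is a cube. *)
Lemma jacobi_coordinates : exists A B : int,
  [/\ qnorm (-1) 1 (A, B) = p%:Z, (3 %| B)%Z &
      (2 %| B)%Z <-> exists x : nat, (x ^ 3 = 2 %[mod p])%N].
Proof.
have Jint : J \in quad_int 3 by apply: rpred_sum => x _; apply: chi_int.
have /quad_intP[A [B JE]] := Jint; exists A, B; split.
- apply: (@intr_inj algC); rewrite -[p%:Z%:~R]/(p%:R) -jacobi_norm JE.
  have -> : (A%:~R + B%:~R * w)^* = A%:~R + B%:~R * (- w - 1).
    by rewrite rmorphD rmorphM /= conj_w !rmorph_int.
  rewrite /qnorm !rmorphD !rmorphM !rmorphN rmorph1 /=.
  transitivity (A%:~R ^+ 2 - A%:~R * B%:~R - B%:~R ^+ 2 * (w ^+ 2 + w) : algC).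
    by rewrite w2; ring.
  ring.
- have [z /quad_intP[k [l ->]] E] := jacobi_mod3.
  have [_ ->] : A = - p%:Z + 3 * k /\ B = 3 * l.
    by apply: wP; rewrite -JE E rmorphD rmorphN !rmorphM /=; ring.
  exact: dvdz_mulr.
have two : (2%:R : F) != 0.
  rewrite -(dvdn_pcharf (pchar_Fp p_prime)); apply/negP => /dvdn_leq.
  by have := prime_gt1 p_prime; lia.
have cubeP : chi 2%:R = 1 <-> exists x : nat, (x ^ 3 = 2 %[mod p])%N.
  have eqF (k l : nat) : (k%:R == l%:R :> F) = (k == l %[mod p])%N.
    by rewrite -val_eqE /= !val_Fp_nat.
  split=> [/(chi_cubeP two)[y yE]|[x /eqP]].
    exists y; apply/eqP; rewrite -eqF natrX natr_Zp; exact/eqP.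
  rewrite -eqF natrX => /eqP xE; rewrite -xE chi_cube //.
  by apply: contraNneq two => x0; rewrite -xE x0 expr0n.
apply: (iff_trans _ cubeP).
have [z /quad_intP[k [l ->]] E] := jacobi_mod2.
have BE (A' B' : int) : chi 2%:R = A'%:~R + B'%:~R * w -> B = B' + 2 * l.
  move=> cE; suff [] : A = A' + 2 * k /\ B = B' + 2 * l by [].
  by apply: wP; rewrite -JE E cE !rmorphD !rmorphM /=; ring.
case: (chiP two) => cE.
- split=> // _; rewrite (BE 1 0) ?cE ?mul0r ?addr0 //; lia.
- split; first by rewrite (BE 0 1) ?cE ?mul1r ?add0r //; lia.
  by rewrite cE => we; case/negP: w_neq1; rewrite we.
split; first by rewrite (BE (-1) (-1)) ?cE ?rmorphN ?rmorph1 ?mulN1r 1?addrC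
  //; lia.
rewrite cE -w2 => we; move: w3; rewrite exprS we mulr1 => e.
by case/negP: w_neq1; rewrite e.
Qed.

End JacobiSum.

Lemma qnorm3_unit e f : qnorm (-1) 1 (e, f) = 1 -> e ^+ 2 <= 1 /\ f ^+ 2 <= 1.
Proof.
rewrite /qnorm /= => E.
by split; [have := sqr_ge0 (2 * f - e)|have := sqr_ge0 (2 * e - f)]; lia.
Qed.

(** The Jacobi sum is x + y t times a unit e + f t, where y = 2 v or -2 v, so B = x f + y (e - f)
    with |f| <= 1. If 3 divides y, then 3 divides B but not x, so f = 0 and B = y e is even. If B is
    even, then f = 0 as x is odd, and 3 divides B = y e. *)
Lemma two_cubic_residue p (u v : int) : prime p -> (p %% 3 = 1)%N ->
  u ^+ 2 + 3 * v ^+ 2 = p%:Z ->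
  (3 %| v)%Z <-> exists x : nat, (x ^ 3 = 2 %[mod p])%N.
Proof.
move=> pp p1 up; have [A [B [AB B3 B2]]] := jacobi_coordinates pp p1.
apply: iff_trans B2; have D : (-1) ^+ 2 - 4 * 1 < 0 :> int by [].
have p0 : p%:Z != 0 by have := prime_gt0 pp; lia.
have pi_norm : qnorm (-1) 1 (u + v, 2 * v) = p%:Z by rewrite -up /qnorm /=;
  ring.
have ABp : (p %| qnorm (-1) 1 (A, B))%Z by rewrite AB dvdzz.
have [[x y] [e [xy [xE yE]]]] : exists z e : int * int,
    qnorm (-1) 1 z = p%:Z /\ (A, B) = qmul (-1) 1 z e /\
    (z.2 = 2 * v \/ z.2 = - (2 * v)).
  have [/qdvdP[e eE]|/qdvdP[e eE]] := orP (qdvd_mulU pp pi_norm ABp).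
    exists (u + v, 2 * v), e; split=> //; split; last by left.
    by apply: (qscale_inj p0); rewrite -qmul_scale -eE qmulK_conj pi_norm.
  exists (qconj (-1) (u + v, 2 * v)), e; split; first by rewrite qnorm_conj.
  split; last by right.
  apply: (qscale_inj p0); rewrite -qmul_scale -eE.
  by rewrite -{2}(qconjK (-1) (u + v, 2 * v)) qmulK_conj qnorm_conj pi_norm.
have e1 : qnorm (-1) 1 e = 1.
  apply: (mulfI p0); rewrite mulr1 -{1}xy -qnormM -xE; exact: AB.
case: e e1 xE => e f ef [_] /= BE; rewrite -/y in yE.
have [e2 f2] := qnorm3_unit ef.
have yv3 : (3 %| y)%Z = (3 %| v)%Z.
  by case: yE => /= ->; rewrite ?rpredN (@Euclidz 3).
have y2 : (2 %| y)%Z by case: yE => /= ->; rewrite ?rpredN dvdz_mulr.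
have {}BE : B = x * f + y * (e - f) by rewrite BE; ring.
have podd : odd p by case: (even_prime pp) p1 => // ->.
have pE : p%:Z = x * (x - y) + y * y by rewrite -xy /qnorm /=; ring.
have x2 : ~~ (2 %| x)%Z.
  apply/negP => x2; have : (2%:Z %| p%:Z)%Z.
    by rewrite pE rpredD // dvdz_mulr.
  by rewrite dvdzE /= dvdn2 podd.
have f01 : (2 %| f)%Z \/ (3 %| f)%Z -> f = 0.
  by move/sqr_le1: f2; rewrite !inE => /or3P[] /eqP -> // [].
split=> [v3|B2].
  have y3 : (3 %| y)%Z by rewrite yv3.
  have x3 : ~~ (3 %| x)%Z.
    apply/negP => x3; have : (3%:Z %| p%:Z)%Z.
      by rewrite pE rpredD // dvdz_mulr.
    by rewrite dvdzE /= /dvdn p1.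
  have xf : (3 %| x * f)%Z.
    have -> : x * f = B - y * (e - f) by rewrite BE addrK.
    by rewrite rpredB // dvdz_mulr.
  have f0 : f = 0.
    by apply: f01; right; move: xf; rewrite (@Euclidz 3) // (negbTE x3).
  by rewrite BE f0 mulr0 add0r dvdz_mulr.
have xf : (2 %| x * f)%Z.
  have -> : x * f = B - y * (e - f) by rewrite BE addrK.
  by rewrite rpredB // dvdz_mulr.
have f0 : f = 0.
  by apply: f01; left; move: xf; rewrite (@Euclidz 2) // (negbTE x2).
rewrite -yv3; have ye : (3 %| y * e)%Z.
  by move: B3; rewrite BE f0 mulr0 add0r subr0.
move: ye; rewrite (@Euclidz 3) // => /orP[//|]; move: ef; rewrite f0.
move/sqr_le1: e2; rewrite !inE => /or3P[] /eqP -> //.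
Qed.

(* The residue y / x mod 3 of z = x + y sqrt(-3) is additive in z under
   multiplication; this is 2 Re of the corresponding cubic character. *)
Definition cubic3 (z : int * int) : int :=
  if (3 %| z.1)%Z then 0 else if (3 %| z.2)%Z then 2 else -1.

Lemma cubic3_scale k z : ~~ (3 %| k)%Z -> cubic3 (qscale k z) = cubic3 z.
Proof.
by move=> /negbTE k3; rewrite /cubic3 /= !(@Euclidz 3) // k3.
Qed.

(** The identity of [cubic2_split] for the character of y / x modulo 3, which conjugating u
    inverts. *)
Lemma cubic3_split u z : ~~ (3 %| u.1)%Z ->
  cubic3 (qmul 0 3 u z) + cubic3 (qmul 0 3 (qconj 0 u) z) =
  (if (3 %| u.2)%Z then 2 else -1) * cubic3 z.
Proof.
case: u z => u1 u2 [x y] /= u13; have E3 s t := @Euclidz 3 isT s t.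
have dvdl s t r : (3 %| u1 * s - 3 * t * r)%Z = (3 %| s)%Z.
  by rewrite rpredBr ?E3 ?(negbTE u13) // -mulrA dvdz_mulr.
rewrite /cubic3 /qmul /qconj /= !mul0r !addr0 !dvdl.
case: ifP => x3; first by rewrite mulr0.
rewrite mulNr; have -> : u1 * y - u2 * x = u1 * y + - (u2 * x) by [].
have [u23|u23] := boolP (3 %| u2)%Z.
  have h : (3 %| u2 * x)%Z by rewrite dvdz_mulr.
  by rewrite !(rpredDr, rpredN) // E3 (negbTE u13) /=; case: ifP.
have [y3|y3] := boolP (3 %| y)%Z.
  have h : (3 %| u1 * y)%Z by rewrite dvdz_mull.
  by rewrite !(rpredDl, rpredN) // E3 x3 (negbTE u23).
(* With all four coordinates prime to 3, the squares are 1 modulo 3, so u1 y + u2 x and u1 y - u2 x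
   have product 0 and nonzero sum modulo 3: exactly one is a multiple of 3. *)
have nd m : ~~ (3 %| m)%Z -> exists k, m ^+ 2 = 3 * k + 1.
  move=> m3; have : m = 3 * (m %/ 3)%Z + 1 \/ m = 3 * (m %/ 3)%Z + 2 by lia.
  move: (m %/ 3)%Z => q [->|->].
    by exists (3 * q ^+ 2 + 2 * q); ring.
  by exists (3 * q ^+ 2 + 4 * q + 1); ring.
have [a aE] := nd _ u13; have [b bE] := nd _ u23.
have [c cE] := nd _ (negbT x3); have [d dE] := nd _ y3.
have prod : (3 %| (u1 * y + u2 * x) * (u1 * y + - (u2 * x)))%Z.
  have -> : (u1 * y + u2 * x) * (u1 * y + - (u2 * x)) =
      u1 ^+ 2 * y ^+ 2 - u2 ^+ 2 * x ^+ 2 by ring.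
  rewrite aE bE cE dE;
    have -> : (3 * a + 1) * (3 * d + 1) - (3 * b + 1) * (3 * c + 1)
    = 3 * (3 * a * d + a + d - 3 * b * c - b - c) by ring.
  exact: dvdz_mulr.
have sum : ~~ (3 %| (u1 * y + u2 * x) + (u1 * y + - (u2 * x)))%Z.
  have -> : (u1 * y + u2 * x) + (u1 * y + - (u2 * x)) = 2 * u1 * y by ring.
  by rewrite !E3 (negbTE u13) (negbTE y3).
move: prod sum; rewrite E3; move: (_ + _) (_ + _) => s t.
case: (boolP (3 %| s)%Z) => s3; case: (boolP (3 %| t)%Z) => t3 //= _.
by rewrite rpredD.
Qed.

Lemma qsum_form27 n : qsum 0 27 (fun=> 1) n =
  qsum 0 3 (fun z => if (3 %| z.2)%Z then 1 else 0) n.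
Proof.
rewrite [RHS]/qsum -big_mkcond /=; symmetry.
apply: (@sum_fset_set_reindex _ _ _ (qsols 0 27 n) _ _ (fun z => (z.1, 3 *
  z.2)) (fun=> 1)).
- exact: finite_qsols.
- exact: finite_qsols.
- by move=> [x y] [x' y'] _ _ [] -> ?; congr (_, _); lia.
- move=> z; rewrite /qsols /= => <-; split; last exact: dvdz_mulr.
  by rewrite /qnorm /=; ring.
move=> [x y] zn /dvdzP[y' /= yE]; exists (x, y'); last by rewrite mulrC -yE.
by rewrite /qsols /= -zn yE /qnorm /=; ring.
Qed.

Lemma prime_1mod3_represented p : prime p -> (p %% 3 = 1)%N ->
  exists u v : int, u ^+ 2 + 3 * v ^+ 2 = p%:Z.
Proof.
move=> pp p1; have podd : odd p by case: (even_prime pp) p1 => // ->.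
have p3 : p != 3%N by lia.
have [|t pt] := @sqr_mod_root 1 3 isT isT erefl p pp podd p3.
  by exists 1; lia.
have [||[x y]] := @euclid_represents (-1) 1 _ _ p pp (ex_intro _ t pt) => //.
  by move=> k z; apply: euclid_formN1.
rewrite /qnorm /= => E.
(* One of y, x, x - y is even, and symmetries of the form reduce to y = 2 k, where x^2 - x y + y^2 =
   (x - k)^2 + 3 k^2. *)
have [k kE] : exists k, [\/ y = 2 * k, x = 2 * k | x - y = 2 * k].
  have [?|[?|?]] : y = 2 * (y %/ 2)%Z \/ x = 2 * (x %/ 2)%Z
    \/ x - y = 2 * ((x - y) %/ 2)%Z by lia.
  - by exists (y %/ 2)%Z; constructor 1.
  - by exists (x %/ 2)%Z; constructor 2.
  by exists ((x - y) %/ 2)%Z; constructor 3.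
case: kE => kE.
- by exists (x - k), k; rewrite -E kE; ring.
- by exists (y - k), k; rewrite -E kE; ring.
by exists (y + k), k; rewrite -E (_ : x = y + 2 * k); [ring|rewrite -kE; ring].
Qed.

(** The argument passes to the Euclidean form x^2 - x y + y^2 through t + sqrt(-3) = (t + 1) + 2 w.
    There a root would make p a norm, hence a square modulo 3; so p would divide the coordinate
    2. *)
Lemma form3_inert p : prime p -> (p %% 3 = 2)%N -> p != 2%N ->
  forall z, (p %| qnorm 0 3 z)%Z -> qdvd p z.
Proof.
move=> pp p3 p2; have pD : prime 3 by [].
apply: no_root_inert => // t; apply/negP => pt.
have : qdvd p (t + 1, 2).
  apply: (@no_root_inert (-1) 1) => //; last first.
    have -> : qnorm (-1) 1 (t + 1, 2) = qnorm 0 3 (t, 1) by rewrite /qnorm /=;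
      ring.
    exact: pt.
  move=> s; apply/negP => ps.
  have [||u up] := @euclid_represents (-1) 1 _ _ p pp (ex_intro _ s ps) => //.
    by move=> k z; apply: euclid_formN1.
  have [r] := @qnorm_sqr_mod 1 3 erefl u p up.
  have : r = 3 * (r %/ 3)%Z \/ r = 3 * (r %/ 3)%Z + 1 \/ r = 3 * (r %/ 3)%Z +
    2 by lia.
  by move: (r %/ 3)%Z => k [->|[->|->]]; lia.
case/andP => _ /= /(@prime_dvd_pow2 p 1 pp) e.
by rewrite e in p2.
Qed.

Lemma form3_ndvd3 n z : ~~ (3 %| n)%N -> qnorm 0 3 z = n%:Z -> ~~ (3 %| z.1)%Z.
Proof.
move=> n3 zn; apply: contra n3 => z3;
  rewrite -[(3 %| n)%N]/(3%:Z %| n%:Z)%Z -zn.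
by rewrite /qnorm mul0r mul0r addr0 rpredD // ?dvdz_mulr // expr2 dvdz_mulr.
Qed.

Lemma card_solX_27_coprime6 n : (0 < n)%N -> gcdn 6 n = 1%N ->
  let t := tau n`_two_noncubic in
  (card_of (solX n 27))%:R
    = 1 / 3 * (1 + 2 * ((kronecker t%:Z 3)%:~R / t%:R))
      * (card_of (solX n 3))%:R :> rat.
Proof.
move=> n0 n6 t; rewrite -![(card_of _)%:R]/((card_of _)%:Z%:~R) !card_solX.
have c6 : coprime 6 n by rewrite /coprime n6.
have n3 : ~~ (3 %| n)%N.
  by rewrite -prime_coprime //; apply: coprime_dvdl c6.
apply: (rat_formula (g := qsum 0 3 cubic3 n)).
- by apply: tau_gt0; exact: part_gt0.
(* The norm being prime to 3, so is z.1, and [1 + cubic3] is three times the indicator of 3 dividing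
   z.2. *)
- rewrite qsum_form27 /qsum big_distrr -big_split /= big_seq [RHS]big_seq.
  apply: eq_bigr => z; rewrite in_qsols // => /eqP zn.
  rewrite /cubic3 (negbTE (form3_ndvd3 n3 zn)).
  by case: ifP => _; rewrite ?mulr1 ?mulr0.
apply: (@hecke_cubic_formula 6) => //.
  move=> p pp p6.
  have p2 : p != 2%N by apply: contraTneq p6 => ->.
  have p3 : ~~ (3 %| p)%N.
    by rewrite -prime_coprime //; apply: coprime_dvdl p6.
  have podd : odd p by case: (even_prime pp) p2 => // ->.
  have scale z : cubic3 (qscale p z) = cubic3 z by apply: cubic3_scale.
  have pD : ~~ (p %| (0 ^+ 2 - 4 * 3)%R)%Z.
    rewrite expr0n sub0r rpredN (@Euclidz p) //; apply/negP => /orP[].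
      by move/(@prime_dvd_pow2 p 2 pp)/eqP; apply/negP.
    rewrite dvdzE /= dvdn_prime2 // => /eqP pe.
    by rewrite pe in p3.
  have [p1|p1] : (p %% 3 = 1 \/ p %% 3 = 2)%N by lia.
    have [u [v up]] := prime_1mod3_represented pp p1.
    have up' : qnorm 0 3 (u, v) = p%:Z by rewrite -up /qnorm /=; ring.
    have u3 := form3_ndvd3 p3 up'.
    have hr : hecke (qsum 0 3 (fun=> 1)) p 2 1 by apply: (hecke_split _ pp up').
    have hg : hecke (qsum 0 3 cubic3) p (if (3 %| v)%Z then 2 else -1) 1.
      by apply: (hecke_split _ pp up') => // z; apply: cubic3_split.
    have vE := two_cubic_residue pp p1 up.
    (* By [two_cubic_residue], the eigenvalue of [cubic3] is 2 exactly when 2 is a cube modulo p. *)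
    case: ifP => [/andP[_ /asboolP nc]|pi].
      move: hg; rewrite ifF //; apply/negP => /vE cu; apply: nc; split=> //.
      by rewrite coprime2n.
    exists 2, 1; split=> //; move: hg; rewrite ifT //; apply/vE.
    apply: contrapT => nc; move/negP: pi; apply; apply/andP; split.
      by rewrite /= p1.
    by apply/asboolP => -[_ /nc].
  rewrite ifF; last by rewrite inE /= p1.
  by exists 0, (-1); split; apply: hecke_inert => //; apply: form3_inert.
rewrite /qsum big_distrr /= big_seq [RHS]big_seq; apply: eq_bigr => -[x y].
rewrite in_qsols // /qnorm /= => /eqP E.
have y0 : y = 0 by have := sqr_ge0 x; nia.
have : x ^+ 2 <= 1 by move: E; rewrite y0; lia.
by move/sqr_le1; rewrite !inE => /or3P[] /eqP xE; move: E; rewrite xE y0.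
Qed.

(** For even n the solutions of x^2 + 3 y^2 = n are all the elements of Z[w] of norm n. The second
    coordinates of z, w z, w^2 z are y, x - y, -x; as 3 does not divide the norm, x + y is nonzero
    modulo 3 and exactly one of them is a multiple of 3. *)
Lemma card_solX_27_even n : (0 < n)%N -> ~~ (3 %| n)%N -> (2 %| n)%N ->
  3 * (card_of (solX n 27))%:Z = (card_of (solX n 3))%:Z.
Proof.
move=> n0 n3 n2; rewrite !card_solX qsum_form27.
have n2' : ~~ odd n by rewrite -dvdn2.
rewrite -[3%N%:Z]/(4 * 1 - 1 : int) -[X in qsum 0 X]/(4 * 1 - 1 : int).
rewrite card_solX_even // qsum_form0_even //.
pose f (z : int * int) : int := if (3 %| z.2)%Z then 1 else 0.
have -> : \sum_(z <- fset_set (qsols (-1) 1 n) | (2 %| z.2)%Z)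
    (if (3 %| (z.1 - (z.2 %/ 2)%Z, (z.2 %/ 2)%Z).2)%Z then 1 else 0 : int)
    = qsum (-1) 1 f n.
  rewrite big_mkcond /qsum big_seq [RHS]big_seq; apply: eq_bigr => z.
  rewrite in_qsols // => /eqP zn; have : qdvd 2 z.
    by rewrite -(@qnorm_dvd2 1) // zn.
  case/andP => _ z2; rewrite z2 /f /=.
  have [k ->] := dvdzP z2.
  by rewrite mulzK // (@Euclidz 3) // orbF.
pose w := (0, 1) : int * int.
have w1 : qnorm (-1) 1 w = 1 by [].
transitivity (qsum (-1) 1 (fun z => f z + f (qmul (-1) 1 w z)
    + f (qmul (-1) 1 w (qmul (-1) 1 w z))) n).
  rewrite /qsum !big_split /= -!/(qsum _ _ _ n).
  rewrite (@qsum_unit _ _ w (fun z => f (qmul (-1) 1 w z))) //.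
  by rewrite (@qsum_unit _ _ w) //; ring.
rewrite /qsum big_seq [RHS]big_seq; apply: eq_bigr => -[x y].
rewrite in_qsols // => /eqP E.
have -> : qmul (-1) 1 w (x, y) = (- y, x - y) by rewrite /qmul /=;
  congr (_, _); ring.
have -> : qmul (-1) 1 w (- y, x - y) = (y - x, - x).
  by rewrite /qmul /=; congr (_, _); ring.
rewrite /f /= rpredN.
have nxy : ~~ (3 %| x + y)%Z.
  apply: contra n3 => xy; rewrite -[(3 %| n)%N]/(3%:Z %| n%:Z)%Z -E.
  have -> : qnorm (-1) 1 (x, y) = (x + y) * (x + y) - 3 * (x * y).
    by rewrite /qnorm /=; ring.
  by rewrite rpredB // dvdz_mulr.
by case: (boolP (3 %| y)%Z); case: (boolP (3 %| x)%Z);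
  case: (boolP (3 %| x - y)%Z); lia.
Qed.

Lemma card_solX_27_dvd3 n : (3 %| n)%N ->
  (solX n 27 !=set0 -> (9 %| n)%N) /\
  ((9 %| n)%N -> card_of (solX n 27) = card_of (solX (n %/ 9) 3)).
Proof.
move=> n3; have x3 x y : x ^+ 2 + 27 * y ^+ 2 = n%:Z -> exists k, x = 3 * k.
  move=> E; have : (3 %| x * x)%Z.
    have -> : x * x = n%:Z - 3 * (9 * y ^+ 2) by rewrite -E; ring.
    by rewrite rpredB // dvdz_mulr.
  by rewrite (@Euclidz 3) // orbb => /dvdzP[k ->]; exists k; rewrite mulrC.
split=> [[[x y]]|n9].
  rewrite /solX /= => E; have [k xE] := x3 _ _ E.
  rewrite -[(9 %| n)%N]/(9%:Z %| n%:Z)%Z -E xE.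
  have -> : (3 * k) ^+ 2 + 27%N%:Z * y ^+ 2 = 9 * (k ^+ 2 + 3 * y ^+ 2) by ring.
  exact: dvdz_mulr.
apply/eqP; rewrite -eqz_nat !card_ofE; apply/eqP.
have nE : n%:Z = 9 * (n %/ 9)%N%:Z by rewrite -{1}(divnK n9) PoszM mulrC.
apply: (@sum_fset_set_reindex _ _ _ (solX (n %/ 9) 3) _ predT (fun z => (3 *
  z.1, z.2)) (fun=> 1)).
- exact: finite_solX.
- exact: finite_solX.
- by move=> [x y] [x' y'] _ _ [] /= ? ->; congr (_, _); lia.
- by move=> [x y]; rewrite /solX /= nE => <-; split=> //; ring.
move=> [x y]; rewrite /solX /= => E _; have [k xE] := x3 _ _ E.
exists (k, y); last by rewrite xE.
by apply: (@mulfI _ 9) => //; rewrite -nE -E xE /=; ring.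
Qed.

Theorem theorem1 (n : nat) (n_gt0 : (0 < n)%N) :
  [/\ (* (I) *)
      (card_of (solX n 1))%:Z
        = 4 * \sum_(c <- divisors n) kronecker (-4) c%:Z
      /\ (card_of (solX n 2))%:Z
        = 2 * \sum_(c <- divisors n) kronecker (-2) c%:Z,
      (* (II) *)
      (~~ odd n ->
         (card_of (solX n 3))%:Z
           = 6 * \sum_(c <- divisors n) kronecker c%:Z 3)
      /\ (odd n ->
         (card_of (solX n 3))%:Z
           = 2 * \sum_(c <- divisors n) kronecker c%:Z 3),
      (* (III) *)
      [/\ (4 %| n)%N ->
            (card_of (solX n 7))%:Z
              = 2 * \sum_(c <- divisors (n %/ 4)) kronecker c%:Z 7,
          ~~ odd n -> ~~ (4 %| n)%N -> solX n 7 = set0 &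
          odd n ->
            (card_of (solX n 7))%:Z
              = 2 * \sum_(c <- divisors n) kronecker c%:Z 7],
      (* (IV) *)
      forall a : nat, heegner a -> (11 <= a)%N ->
        (~~ odd n -> card_of (solX n a) = card_of (solY n a))
        /\ (odd n ->
              let t := tau n`_(nonrep_residues a) in
              (card_of (solX n a))%:R
                = 1 / 3 * (1 + 2 * ((kronecker t%:Z 3)%:~R / t%:R))
                  * (card_of (solY n a))%:R :> rat) &
      (* (V) *)
      [/\ (3 %| n)%N ->
            (solX n 27 !=set0 -> (9 %| n)%N)
            /\ ((9 %| n)%N ->
                  card_of (solX n 27) = card_of (solX (n %/ 9) 3)),
          ~~ (3 %| n)%N -> (2 %| n)%N ->
            (card_of (solX n 27))%:R
              = 1 / 3 * (card_of (solX n 3))%:R :> rat &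
          gcdn 6 n = 1%N ->
            let t := tau n`_two_noncubic in
            (card_of (solX n 27))%:R
              = 1 / 3 * (1 + 2 * ((kronecker t%:Z 3)%:~R / t%:R))
                * (card_of (solX n 3))%:R :> rat]].
Proof.
split.
- exact: card_solX_1_2.
- exact: card_solX_3.
- exact: card_solX_7.
- by move=> a ha a11; exact: card_solX_heegner.
split.
- exact: card_solX_27_dvd3.
- move=> n3 n2; rewrite -![(card_of _)%:R]/((card_of _)%:Z%:~R).
  by rewrite -(card_solX_27_even n_gt0 n3 n2) rmorphM /= mulrA mul1r mulVf
    ?mul1r.
exact: card_solX_27_coprime6.
Qed.
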